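(* Let $d\ge 3$, $v>0$, $c\in(0,1)$, let $\nu\ge 2$ be an integer and $Z_1\sim N_d(0,I)$. Then $$\Delta_u\left\{E_{Z_1}\!\left[m_H^{\nu}(tZ_1+u,\,v)\right]\right\}^{c/\nu}\le 0\quad\text{for all }u\in\mathbb{R}^d$$ whenever $$0\le t\le\left(\frac{(d+2)(1-c)v}{d\,\nu(\nu-1)}\right)^{1/2}.$$
   Context: $\phi(\cdot,\sigma^2)$ is the density of $N_d(0,\sigma^2I)$. The harmonic prior is $\pi_H(\mu)=\|\mu\|^{-(d-2)}$ and $m_H(w,v)=\int_{\mathbb{R}^d}\phi(w-\mu,v)\|\mu\|^{-(d-2)}\,d\mu$. *)

(* Defs.v *)
From HB Require Import structures.
From mathcomp Require Import all_boot all_order all_algebra.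
From mathcomp Require Import all_classical all_reals all_analysis.
Set Implicit Arguments. Unset Strict Implicit. Unset Printing Implicit Defensive.
Import Order.TTheory GRing.Theory Num.Theory.
Import numFieldNormedType.Exports.
Local Open Scope classical_set_scope.
Local Open Scope ring_scope.

Section defs.
Variable R : realType.

(* Iterated (Fubini/Tonelli) Lebesgue integral over R^n of a [0,+oo]-valued
   function of the coordinates 0..n-1 (coordinates >= n are fixed to 0). *)
Fixpoint iint (n : nat) (f : (nat -> R) -> \bar R) : \bar R :=
  match n with
  | 0 => f (fun _ => 0)
  | n'.+1 => (\int[@lebesgue_measure R]_(x in [set: R])
               iint n' (fun y => f (fun i => if i == n' then x else y i)))%E
  end.

Definition intRd (d : nat) (f : 'rV[R]_d -> \bar R) : \bar R :=
  iint d (fun g => f (\row_(i < d) g (i : nat))).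

(* Euclidean norm on R^d (the canonical norm on 'rV is the sup norm). *)
Definition enorm (d : nat) (x : 'rV[R]_d) : R :=
  Num.sqrt (\sum_(i < d) x ord0 i ^+ 2).

Definition phi (d : nat) (x : 'rV[R]_d) (s : R) : R :=
  (Num.sqrt (2 * pi * s) ^+ d)^-1 * expR (- (enorm x ^+ 2) / (2 * s)).

(* harmonic prior pi_H(mu) = ||mu||^{-(d-2)} (value at mu = 0 irrelevant). *)
Definition piH (d : nat) (mu : 'rV[R]_d) : R := (enorm mu ^+ (d - 2))^-1.

(* m_H(w, v) = \int phi(w - mu, v) ||mu||^{-(d-2)} dmu  (finite for d >= 3). *)
Definition mH (d : nat) (w : 'rV[R]_d) (v : R) : R :=
  fine (intRd (fun mu => (phi (w - mu) v * piH mu)%:E)).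

(* E_{Z1}[ g(Z1) ] for Z1 ~ N_d(0, I) and g >= 0. *)
Definition EZ (d : nat) (g : 'rV[R]_d -> R) : R :=
  fine (intRd (fun z => (phi z 1 * g z)%:E)).

Definition ebasis (d : nat) (i : 'I_d) : 'rV[R]_d := delta_mx ord0 i.

Definition laplacian (d : nat) (F : 'rV[R]_d -> R) (u : 'rV[R]_d) : R :=
  \sum_(i < d) derive (fun x => derive F x (ebasis i)) u (ebasis i).

Definition Fpow (d nu : nat) (t v c : R) (u : 'rV[R]_d) : R :=
  powR (EZ (fun z => mH (t *: z + u) v ^+ nu)) (c / nu%:R).

End defs.

(* Main.v *)
(** Write a = (d-2)/2 and b = 1/a.  Since |mu|^(-2a) is a constant multiple of
    the integral of exp(-|mu|^2 x^b / 2) over x > 0, the marginal m_H(w,v) is a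
    constant multiple of E exp(-|w|^2 X^b / (2v)) with X uniform on [0,1].
    Expanding the power and integrating out Z_1, the expectation becomes
    g(r) = E[exp(-r kappa(L)) (1 + tau L)^(-d/2)] with r = |u|^2/(2v),
    tau = t^2/v, kappa(l) = l/(1 + tau l) and L a sum of nu independent copies
    of X^b.  Superharmonicity of g(|u|^2/(2v))^(c/nu) is the inequality
      M0 (r M2) <= (d/2) M0 M1 + (1 - c/nu) M1 (r M1)
    between the moments Mj of kappa(L)^j.  Integrating by parts in one copy of X
    (whose effect is the same for all copies, by symmetry) expresses r M1 and
    r M2 through lower moments and boundary terms at X = 1.  The boundary terms
    have the right sign by Chebyshev's inequality, since the weight is log-convex
    in L; what remains is E[L kappa] <= nu (d/(d+2)) E[kappa], for which the bound
    on t is exactly what is needed. *)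
Require Import Defs.
From HB Require Import structures.
From mathcomp Require Import all_boot all_order all_algebra.
From mathcomp Require Import all_classical all_reals all_analysis.
From mathcomp Require Import measurable_realfun.
From mathcomp Require Import ring lra.
Set Implicit Arguments. Unset Strict Implicit. Unset Printing Implicit Defensive.
Import Order.TTheory GRing.Theory Num.Theory.
Import numFieldNormedType.Exports.
Local Open Scope classical_set_scope.
Local Open Scope ring_scope.

(** The scale is parametrised by [x] with precision [x^b] because this absorbs the density
    [a y^(a-1)] of [y = x^b], which is singular at 0 when d = 3, into plain Lebesgue measure. The
    derivative of [x^b] may blow up at 0 instead, but integration by parts is applied to
    [x f(s + x^b)], where only [x (x^b)' = b x^b] occurs. No density of the sum L is ever needed:
    its law is known only through the integrals that add one copy at a time, and parts are taken in
    one copy with the sum of the others held fixed. The constant d/(d+2) is (a+1)/(a+2), the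
    quotient of E X^(2b) = a/(a+2) by E X^b = a/(a+1). It governs a single copy whose weight is
    exactly linear in L. After both integrations by parts, the coefficient nu - c of M1 splits as
    (nu - 1) + (1 - c). The part nu - 1 cancels, and the slack 1 - c has to pay for (nu - 1) tau
    E[L kappa]; this is where the size of t enters. *)

Section pointwise_derivatives.
Variable R : realType.
Implicit Types (f g : R -> R) (x c df dg : R).

(** * Rules for continuity and derivatives of real functions *)

Lemma continuousT_comp f g : continuous f -> continuous g ->
  continuous (fun x => g (f x)).
Proof.
by move=> cf cg x; apply: (@continuous_comp R R R f g); [exact: cf|exact: cg].
Qed.

Lemma continuous_addT f g : continuous f -> continuous g ->
  continuous (fun x => f x + g x).
Proof. by move=> cf cg x; exact: cvgD (cf x) (cg x). Qed.

Lemma continuous_mulT f g : continuous f -> continuous g ->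
  continuous (fun x => f x * g x).
Proof. by move=> cf cg x; exact: cvgM (cf x) (cg x). Qed.

Lemma continuous_oppT f : continuous f -> continuous (fun x => - f x).
Proof. by move=> cf x; exact: cvgN (cf x). Qed.

Lemma continuous_cstT c : continuous (fun _ : R => c).
Proof. by move=> x; exact: cvg_cst. Qed.

Lemma continuous_invT f : continuous f -> (forall x, f x != 0) ->
  continuous (fun x => (f x)^-1).
Proof. by move=> cf f0 x; exact: cvgV (f0 x) (cf x). Qed.

Lemma continuous_expRT f : continuous f -> continuous (fun x => expR (f x)).
Proof. by move=> cf; exact: (continuousT_comp cf (@continuous_expR R)). Qed.

Lemma continuous_powRT f p : continuous f -> (forall x, 0 < f x) ->
  continuous (fun x => f x `^ p).
Proof.
move=> cf f0 x; suff : {for x, continuous ((fun y : R => y `^ p) \o f)} by [].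
apply: continuous_comp; first exact: cf.
apply/differentiable_continuous/derivable1_diffP/derivable_powR.
by rewrite in_itv /= andbT.
Qed.

Lemma continuous_measurable_EFin (D : set (measurableTypeR R)) f : continuous f ->
  measurable_fun D (fun x => (f x)%:E).
Proof.
move=> cf; apply/measurable_EFinP; apply: measurable_funTS.
exact: continuous_measurable_fun.
Qed.

Lemma is_derive_eq_near f g x df :
  {near x, f =1 g} -> is_derive x 1 f df -> is_derive x 1 g df.
Proof.
move=> fg [df1 df2]; split; first exact: near_eq_derivable fg df1.
by rewrite -df2; apply/esym; exact: near_eq_derive.
Qed.

Lemma is_derive_compR f g x df dg : is_derive (g x) 1 f df ->
  is_derive x 1 g dg -> is_derive x 1 (fun y => f (g y)) (df * dg).
Proof. by move=> d1 d2; exact: is_derive1_comp. Qed.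

Lemma is_derive_addR f g x df dg : is_derive x 1 f df -> is_derive x 1 g dg ->
  is_derive x 1 (fun y => f y + g y) (df + dg).
Proof. by move=> d1 d2; exact: is_deriveD. Qed.

Lemma is_derive_mulR f g x df dg : is_derive x 1 f df -> is_derive x 1 g dg ->
  is_derive x 1 (fun y => f y * g y) (df * g x + f x * dg).
Proof.
move=> d1 d2; apply: (is_derive_eq (is_deriveM d1 d2)).
by rewrite /GRing.scale /= addrC [g x * _]mulrC.
Qed.

Lemma is_derive_cstR c x : is_derive x 1 (fun=> c) 0.
Proof. exact: is_derive_cst. Qed.

Lemma is_derive_oppR f x df : is_derive x 1 f df ->
  is_derive x 1 (fun y => - f y) (- df).
Proof. by move=> d1; exact: is_deriveN. Qed.

Lemma is_derive_scaleR c f x df : is_derive x 1 f df ->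
  is_derive x 1 (fun y => c * f y) (c * df).
Proof. by move=> d1; exact: is_deriveZ. Qed.

Lemma is_derive_invR f x df : is_derive x 1 f df -> f x != 0 ->
  is_derive x 1 (fun y => (f y)^-1) (- df / f x ^+ 2).
Proof.
move=> d1 f0; apply: (is_derive_eq (is_deriveV f0 d1)).
by rewrite /GRing.scale /= !mulNr mulrC.
Qed.

Lemma is_derive_powRR f x df p : is_derive x 1 f df -> 0 < f x ->
  is_derive x 1 (fun y => f y `^ p) (p * f x `^ (p - 1) * df).
Proof.
by move=> d1 f0; apply: (@is_derive_compR (fun y => y `^ p)) => //;
  exact: is_derive1_powR.
Qed.

Lemma is_derive_expRR f x df : is_derive x 1 f df ->
  is_derive x 1 (fun y => expR (f y)) (expR (f x) * df).
Proof. by move=> d1; apply: is_derive_compR. Qed.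

Lemma is_derive_continuous f x df : is_derive x 1 f df -> {for x, continuous f}.
Proof. by move=> [+ _] => /derivable1_diffP/differentiable_continuous. Qed.

End pointwise_derivatives.

(** * Tonelli's theorem for iterated integrals *)

Section iterated.
Variable R : realType.
Local Notation mu := (@lebesgue_measure R).

Lemma eq_iint n (f g : (nat -> R) -> \bar R) : f =1 g -> iint n f = iint n g.
Proof. by move=> /funext ->. Qed.

(** Tonelli, one coordinate at a time: given [x], the integrand factors over the coordinates. The
    weight [c] is general because the induction moves the factor of the outermost coordinate into
    it. It serves twice, for the scale of the prior and for the law of the sum of scales. *)
Lemma iint_prod dX (X : measurableType dX)
    (m : {sigma_finite_measure set X -> \bar R})
    (h : nat -> X -> R -> R) (H : nat -> X -> R) n (c : X -> R) :
  (forall x, 0 <= c x) -> measurable_fun [set: X] c ->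
  (forall i x y, 0 <= h i x y) ->
  (forall i, measurable_fun [set: X * R] (fun p => h i p.1 p.2)) ->
  (forall i, measurable_fun [set: X] (H i)) ->
  (forall i x, (\int[mu]_y (h i x y)%:E = (H i x)%:E)%E) ->
  iint n (fun y => (\int[m]_x (c x * \prod_(i < n) h i x (y i))%:E)%E) =
  (\int[m]_x (c x * \prod_(i < n) H i x)%:E)%E.
Proof.
move=> + + h0 mh mH hH.
have H0 i x : 0 <= H i x.
  by rewrite -lee_fin -hH; apply: integral_ge0 => y _; rewrite lee_fin.
elim: n c => [|n IH] c c0 mc /=.
  by apply: eq_integral => x _; rewrite !big_ord0.
have E z : iint n (fun y => (\int[m]_x (c x * \prod_(i < n.+1)
      h i x (if i == n :> nat then z else y i))%:E)%E) =
    (\int[m]_x (c x * h n x z * \prod_(i < n) H i x)%:E)%E.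
  rewrite -(IH (fun x => c x * h n x z)); last 2 first.
    by move=> x; rewrite mulr_ge0.
    by apply: measurable_funM => //; exact: (measurable_fun_pair1 z (mh n)).
  apply: eq_iint => y; apply: eq_integral => x _; congr (_%:E).
  rewrite big_ord_recr /= eqxx -mulrA [X in _ = _ * X]mulrC; congr (_ * (_ * _)).
  by apply: eq_bigr => i _; rewrite (ltn_eqF (ltn_ord i)).
under eq_integral => z _ do rewrite E.
rewrite /= -(@fubini_tonelli _ _ _ _ _ m mu
   (fun p => (c p.1 * h n p.1 p.2 * \prod_(i < n) H i p.1)%:E)) /=; last 2 first.
- apply/measurable_EFinP; apply: measurable_funM.
    by apply: measurable_funM; [exact: (measurableT_comp mc)|exact: mh].
  by apply: (@measurable_prod _ _ _ _ _ (index_enum _) (fun i p => H (val i) p.1)) => i _; exact: (measurableT_comp (mH i)).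
- by move=> x; rewrite lee_fin; apply: mulr_ge0; [rewrite mulr_ge0|exact: prodr_ge0].
apply: eq_integral => x _.
under eq_integral => y _ do rewrite mulrAC EFinM.
rewrite ge0_integralZl//; last 3 first.
- apply/measurable_EFinP; exact: (measurable_fun_pair2 x (mh n)).
- by move=> y _; rewrite lee_fin.
- by rewrite lee_fin mulr_ge0// prodr_ge0.
by rewrite hH -EFinM big_ord_recr /= mulrA.
Qed.

End iterated.

(** * One-dimensional Gaussian integrals *)

Section gaussian.
Variable R : realType.
Local Notation mu := (@lebesgue_measure R).

Definition gauss1 (s x : R) : R :=
  (Num.sqrt (2 * pi * s))^-1 * expR (- x ^+ 2 / (2 * s)).

(** Completing the square in [z] turns the integrand into a constant times the normal density with
    variance [s / D] and mean [m']. It is used once to integrate out [mu] and once to integrate out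
    [Z_1]. *)
Lemma integral_gauss1_expR (m s q al be : R) : 0 < s -> 0 <= q ->
  (\int[mu]_z (gauss1 s (z - m) * expR (- (q * (al * z + be) ^+ 2 / 2)))%:E =
  ((Num.sqrt (1 + s * q * al ^+ 2))^-1 *
     expR (- (q * (al * m + be) ^+ 2 / (2 * (1 + s * q * al ^+ 2)))))%:E)%E.
Proof.
move=> s0 q0.
set D := 1 + s * q * al ^+ 2.
have D0 : 0 < D.
  by rewrite ltr_pwDl// mulr_ge0 ?sqr_ge0// mulr_ge0// ltW.
have Dn0 : D != 0 by rewrite gt_eqF.
have sn0 : s != 0 by rewrite gt_eqF.
pose sg := Num.sqrt (s / D).
have sg0 : 0 < sg by rewrite sqrtr_gt0 divr_gt0.
have sg2 : sg ^+ 2 = s / D by rewrite sqr_sqrtr// ltW// divr_gt0.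
pose m' := (m - s * q * al * be) / D.
rewrite -[RHS]mule1 -(integral_normal_pdf m' sg) -ge0_integralZl//; last 2 first.
- by apply/measurable_EFinP; exact: measurable_normal_pdf.
- by move=> z _; rewrite lee_fin normal_pdf_ge0.
apply: eq_integral => z _; rewrite -EFinM; congr (_%:E).
rewrite normal_pdfE ?gt_eqF// /normal_peak /normal_fun /gauss1 sg2.
rewrite -[LHS]mulrA -expRD [RHS]mulrACA -expRD; congr (_ * expR _); last first.
  rewrite /m'; move: Dn0; rewrite /D => Dn0; field.
  by rewrite sn0 Dn0.
rewrite -invfM -sqrtrM ?ltW//; congr ((Num.sqrt _)^-1).
by field.
Qed.

End gaussian.

(** * Integrals over the scale variable *)

Section radial.
Variable R : realType.
Local Notation mu := (@lebesgue_measure R).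

(** The absolute value makes the power continuous on the whole line, so that later integrands need
    no restriction of their domain. *)
Lemma continuous_norm_powR (b : R) : 0 < b ->
  continuous (fun x : R => `|x| `^ b).
Proof.
move=> b0 x; have [->|xn0] := eqVneq x 0.
  rewrite /continuous_at normr0 powR0 ?gt_eqF//.
  apply/cvgr0Pnorm_lt => e e0; near=> y.
  rewrite ger0_norm ?powR_ge0//.
  rewrite -[ltRHS](@powRr1 R e) ?ltW// -(mulVf (lt0r_neq0 b0)) powRrM.
  rewrite gt0_ltr_powR// ?nnegrE ?powR_ge0//.
  near: y; exists (e `^ b^-1) => /=; first by rewrite powR_gt0.
  by move=> z /=; rewrite sub0r normrN.
suff : {for x, continuous ((fun y : R => y `^ b) \o (fun x : R => `|x|))} by [].
apply: continuous_comp; first exact: norm_continuous.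
apply/differentiable_continuous/derivable1_diffP/derivable_powR.
by rewrite in_itv /= andbT normr_gt0.
Unshelve. all: by end_near. Qed.

(** The margin around [[0, 1]] makes both endpoints interior points, where the primitive is
    differentiable and hence continuous. *)
Lemma exists_primitive (h : R -> R) : continuous h ->
  exists H : R -> R, forall z : R, -1 < z < 2 -> is_derive z 1 H (h z).
Proof.
move=> ch; exists (fun x => \int[mu]_(t in `[-1, x]) h t)%R => z /andP[z1 z2].
have hi : mu.-integrable `[-1, 2] (EFin \o h).
  apply: continuous_compact_integrable; first exact: segment_compact.
  exact: continuous_subspaceT.
have [dH H'] := continuous_FTC1_closed z2 hi z1 (ch z).
by apply: DeriveDef => //; rewrite -derive1E.
Qed.

Lemma integral_primitive (h H : R -> R) : continuous h ->
  (forall z : R, -1 < z < 2 -> is_derive z 1 H (h z)) ->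
  (\int[mu]_(x in `[0%R, 1%R]) (h x)%:E = (H 1 - H 0)%:E)%E.
Proof.
move=> ch dH.
have cH (z : R) : -1 < z < 2 -> {for z, continuous H}.
  by move=> /dH[+ _]; move=> /derivable1_diffP/differentiable_continuous.
rewrite (@continuous_FTC2 _ h H) ?ltr01//.
- exact: continuous_subspaceT.
- split.
  + by move=> x /[!in_itv]/= /andP[x0 x1]; have [] := dH x _; [lra|].
  + by apply: cvg_at_right_filter; apply: cH; lra.
  + by apply: cvg_at_left_filter; apply: cH; lra.
- move=> x /[!in_itv]/= /andP[x0 x1]; rewrite derive1E.
  by have [] := dH x _; [lra|].
Qed.

Section substitution.
Variables (a v : R).
Hypotheses (a0 : 0 < a) (v0 : 0 < v).
Let b := a^-1.
Let b0 : 0 < b. Proof. by rewrite invr_gt0. Qed.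
(** [F] maps [[0, +oo[] into [[0, 1]]. Its power [F x ^ b] is the fraction that stands in the
    exponent once [mu] has been integrated out. *)
Let F (x : R) : R := (v * `|x| `^ b / (1 + v * `|x| `^ b)) `^ a.

Let den0 (x : R) : 0 < 1 + v * `|x| `^ b.
Proof. by rewrite ltr_pwDl// mulr_ge0 ?powR_ge0// ltW. Qed.

Let F01 (x : R) : 0 <= F x <= 1.
Proof.
rewrite powR_ge0/=.
have <- : 1 `^ a = 1 :> R by rewrite powR1.
apply: ge0_ler_powR; rewrite ?nnegrE ?(ltW a0)//.
- by apply: divr_ge0; [rewrite mulr_ge0 ?powR_ge0 ?(ltW v0)|exact: ltW].
- by rewrite ler_pdivrMr// mul1r lerDr.
Qed.

(** For [x > 0], [F x = v^a x (1 + v x^b)^(-a)]. Since [a b = 1], the two terms of the product rule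
    combine to [1 + v x^b - v x^b = 1] times the stated power. *)
Let is_derive_F (x : R) : 0 < x ->
  is_derive x 1 F (v `^ a * (1 + v * `|x| `^ b) `^ (- (a + 1))).
Proof.
move=> x0; pose F' (x : R) : R := (v * x `^ b / (1 + v * x `^ b)) `^ a.
apply: (@is_derive_eq_near R F').
  near=> y; rewrite /F /F' ger0_norm//; apply: ltW; near: y.
  exact: lt_nbhsr.
have p0 : 0 < x `^ b by rewrite powR_gt0.
have D0 : 0 < 1 + v * x `^ b by have := den0 x; rewrite gtr0_norm.
have u0 : 0 < v * x `^ b / (1 + v * x `^ b).
  by rewrite divr_gt0// mulr_gt0.
have dvp := is_derive_scaleR v (@is_derive1_powR R b x x0).
have dD := is_derive_addR (is_derive_cstR 1 x) dvp.
have du := is_derive_mulR dvp (is_derive_invR dD (lt0r_neq0 D0)).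
apply: (is_derive_eq (is_derive_powRR a du u0)).
rewrite gtr0_norm//.
set D := 1 + v * x `^ b in D0 *.
have -> : (v * x `^ b / D) `^ (a - 1) =
    v `^ a / v * (x / x `^ b) * (D `^ (- (a + 1)) * D ^+ 2).
  rewrite powRM ?invr_ge0 ?(ltW D0) ?(ltW (mulr_gt0 v0 p0))//.
  rewrite powRM ?(ltW v0) ?(ltW p0)// powRB ?(gt_eqF v0) ?implybT//.
  rewrite (powRr1 (ltW v0)); congr (_ * _ * _).
    rewrite -powRrM mulrBr mulr1 mulVf ?(gt_eqF a0)//.
    by rewrite powRB ?(gt_eqF x0) ?implybT// powRr1 ?ltW.
  rewrite -powR_inv1 ?(ltW D0)// -powRrM -(powR_mulrn 2) ?(ltW D0)//.
  rewrite -powRD ?(gt_eqF D0) ?implybT//.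
  by congr (_ `^ _); ring.
have -> : x `^ (b - 1) = x `^ b / x by rewrite powRB ?(gt_eqF x0) ?implybT// powRr1// ltW.
rewrite /D /b; field.
rewrite !gt_eqF //.
Unshelve. all: by end_near. Qed.

Let cvg_u : (v * `|x| `^ b / (1 + v * `|x| `^ b)) @[x --> +oo%R] --> (1 : R).
Proof.
apply/cvgrPdist_lt => e e0; near=> x.
have -> : 1 - v * `|x| `^ b / (1 + v * `|x| `^ b) = (1 + v * `|x| `^ b)^-1.
  by field; rewrite gt_eqF.
rewrite ger0_norm ?invr_ge0 ?(ltW (den0 x))// invf_plt ?posrE//.
rewrite (@lt_trans _ _ (v * `|x| `^ b)) ?ltrDr ?ltr01//.
rewrite -ltr_pdivrMl//.
have -> : v^-1 * e^-1 = ((v^-1 * e^-1) `^ a) `^ b.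
  rewrite -powRrM mulfV ?gt_eqF// powRr1//.
  by rewrite mulr_ge0// invr_ge0 ltW.
rewrite gt0_ltr_powR// ?nnegrE ?powR_ge0//.
by rewrite (lt_le_trans _ (ler_norm x)).
Unshelve. all: by end_near. Qed.

Let cvg_F : F x @[x --> +oo%R] --> (1 : R).
Proof.
have <- : 1 `^ a = 1 :> R by rewrite powR1.
apply: (@cvg_comp _ _ _ (fun x : R => v * `|x| `^ b / (1 + v * `|x| `^ b))
  (fun y => y `^ a) _ _ _ cvg_u).
exact: (is_derive_continuous (is_derive1_powR a ltr01)).
Qed.

Let continuous_den : continuous (fun x : R => 1 + v * `|x| `^ b).
Proof.
apply: continuous_addT; first exact: continuous_cstT.
by apply: continuous_mulT; [exact: continuous_cstT|exact: continuous_norm_powR].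
Qed.

Let continuous_u : continuous (fun x : R => v * `|x| `^ b / (1 + v * `|x| `^ b)).
Proof.
apply: continuous_mulT; first by apply: continuous_mulT;
  [exact: continuous_cstT|exact: continuous_norm_powR].
by apply: continuous_invT => // x; rewrite gt_eqF.
Qed.

Let continuous_F : continuous F.
Proof.
have -> : F = fun x : R => `|v * `|x| `^ b / (1 + v * `|x| `^ b)| `^ a.
  apply/funext => x; rewrite /F [X in _ = X `^ a]ger0_norm//.
  by apply: divr_ge0; [rewrite mulr_ge0 ?powR_ge0 ?(ltW v0)|exact: ltW].
exact: (continuousT_comp continuous_u (continuous_norm_powR a0)).
Qed.

(** Change of variables [y = F x], by the fundamental theorem on the half-line for [H (F x)] with
    [H] a primitive of [h]. At 0 only continuity is used. *)
Lemma integral_substitution_fraction (h : R -> R) :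
  continuous h -> (forall x, 0 <= h x) ->
  (\int[mu]_(x in `[0%R, +oo[) (h ((v * `|x| `^ b / (1 + v * `|x| `^ b)) `^ a) *
    (v `^ a * (1 + v * `|x| `^ b) `^ (- (a + 1))))%:E =
  \int[mu]_(x in `[0%R, 1%R]) (h x)%:E)%E.
Proof.
move=> ch h0; have [H dH] := exists_primitive ch.
rewrite (integral_primitive ch dH).
have F1 x : -1 < F x < 2 by have := F01 x; lra.
have F0 : F 0 = 0.
  by rewrite /F normr0 powR0 ?gt_eqF// mulr0 mul0r powR0 ?gt_eqF.
have dHF (x : R) : 0 < x -> is_derive x 1 (fun x => H (F x))
   (h (F x) * (v `^ a * (1 + v * `|x| `^ b) `^ (- (a + 1)))).
  by move=> x0; apply: is_derive_compR; [exact: dH|exact: is_derive_F].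
have cH (z : R) : -1 < z < 2 -> {for z, continuous H}.
  by move=> /dH; exact: is_derive_continuous.
rewrite (@ge0_continuous_FTC2y R _ (fun x => H (F x)) 0 (H 1)).
- by rewrite F0 EFinB.
- by move=> x _; rewrite mulr_ge0// mulr_ge0// powR_ge0.
- apply: continuous_subspaceT; apply: continuous_mulT.
    exact: (continuousT_comp continuous_F ch).
  by apply: continuous_mulT; [exact: continuous_cstT|exact: continuous_powRT].
- apply: (@cvg_comp _ _ _ F H _ _ _ cvg_F).
  by apply: cH; lra.
- by move=> x x0; have [] := dHF x x0.
- apply: cvg_at_right_filter.
  suff : {for 0, continuous (H \o F)} by [].
  apply: continuous_comp; first exact: continuous_F.
  by apply: cH; rewrite F0; lra.
- move=> x /[!in_itv]/=; rewrite andbT => x0.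
  by rewrite derive1E; have [_ ->] := dHF x x0.
Qed.

End substitution.

Variables (a : R).
Hypotheses (a0 : 0 < a).
Let b := a^-1.
Let b0 : 0 < b. Proof. by rewrite invr_gt0. Qed.

(** The power [-(a + 1) = -d/2] produced by the Gaussian integrals is exactly the Jacobian of [F],
    which is why the mixing variable becomes uniform on [[0, 1]]. *)
Lemma integral_rational_exp (v q : R) : 0 < v ->
  (\int[mu]_(x in `[0%R, +oo[) ((1 + v * `|x| `^ b) `^ (- (a + 1)) *
     expR (- (q * `|x| `^ b / (1 + v * `|x| `^ b))))%:E =
  (v `^ (- a))%:E * \int[mu]_(x in `[0%R, 1%R]) (expR (- (q / v * `|x| `^ b)))%:E)%E.
Proof.
move=> v0.
have den0 (x : R) : 0 < 1 + v * `|x| `^ b.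
  by rewrite ltr_pwDl// mulr_ge0 ?powR_ge0// ltW.
rewrite -(@integral_substitution_fraction a v a0 v0
   (fun x => expR (- (q / v * `|x| `^ b)))); last 2 first.
- apply/continuous_expRT/continuous_oppT/continuous_mulT.
    exact: continuous_cstT.
  exact: continuous_norm_powR.
- by move=> x; exact: expR_ge0.
have cden : continuous (fun x : R => 1 + v * `|x| `^ b).
  apply: continuous_addT; first exact: continuous_cstT.
  by apply: continuous_mulT; [exact: continuous_cstT|exact: continuous_norm_powR].
pose G (x : R) := (1 + v * `|x| `^ b) `^ (- (a + 1)) *
  expR (- (q * `|x| `^ b / (1 + v * `|x| `^ b))).
transitivity ((v `^ (- a))%:E *
    \int[mu]_(x in `[0%R, +oo[) ((v `^ a)%:E * (G x)%:E))%E; last first.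
  congr (_ * _)%E; apply: eq_integral => x _; rewrite -EFinM; congr (_%:E).
  rewrite -/b [RHS]mulrCA; congr (_ * _); rewrite [RHS]mulrC /G.
  congr (_ * expR (- _)).
  have u0 : 0 <= v * `|x| `^ b / (1 + v * `|x| `^ b).
    by apply: divr_ge0; [rewrite mulr_ge0 ?powR_ge0 ?(ltW v0)|exact: ltW].
  rewrite (@ger0_norm _ (_ `^ a)) ?powR_ge0// -powRrM mulfV ?gt_eqF// powRr1//.
  by field; rewrite !gt_eqF.
rewrite ge0_integralZl//; last 3 first.
- apply: continuous_measurable_EFin.
  apply: continuous_mulT; first exact: continuous_powRT.
  apply/continuous_expRT/continuous_oppT/continuous_mulT.
    by apply: continuous_mulT; [exact: continuous_cstT|exact: continuous_norm_powR].
  by apply: continuous_invT => // x; rewrite gt_eqF.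
- by move=> x _; rewrite lee_fin mulr_ge0 ?expR_ge0// powR_ge0.
- by rewrite lee_fin powR_ge0.
by rewrite muleA -EFinM powRN mulVf ?gt_eqF ?powR_gt0// mul1e.
Qed.

(** Write [expR (z / 2)] as the power [a + 1] of [expR (z / (2 (a + 1)))] and use [expR y >= 1 + y].
    The bound dominates the exponential by a function whose integral is already known. *)
Lemma expR_powR_bound (z : R) : 0 <= z ->
  expR (- (z / 2)) <= (2 * (a + 1)) `^ (a + 1) * (1 + z) `^ (- (a + 1)).
Proof.
move=> z0; have a1 : 0 < a + 1 by rewrite addr_gt0.
have z1 : 0 < 1 + z by rewrite ltr_pwDl.
rewrite powRN ler_pdivlMr ?powR_gt0// expRN -ler_pdivlMl ?invr_gt0 ?expR_gt0// invrK.
have -> : expR (z / 2) = expR (z / (2 * (a + 1))) `^ (a + 1).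
  by rewrite -expRM; congr expR; field; rewrite gt_eqF.
rewrite -powRM ?expR_ge0//; last by rewrite mulr_ge0// ltW.
apply: ge0_ler_powR; rewrite ?nnegrE; [exact: ltW|exact: ltW| |].
  by rewrite mulr_ge0 ?expR_ge0// mulr_ge0// ltW.
rewrite -ler_pdivrMr ?mulr_gt0//.
apply: le_trans (expR_ge1Dx _).
rewrite mulrDl lerD2r mul1r invf_le1 ?mulr_gt0//.
by rewrite mulrDr mulr1 -[leLHS]add0r lerD// ?ler1n// mulr_ge0// ltW.
Qed.

(** [K] normalises the scale mixture and will be inverted. It is positive because of [[0, 1]], and
    finite by domination with the case [v = 1], [q = 0] of [integral_rational_exp]. *)
Lemma integral_expR_fin_gt0 : exists2 K : R, 0 < K &
  (\int[mu]_(x in `[0%R, +oo[) (expR (- (`|x| `^ b / 2)))%:E = K%:E)%E.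
Proof.
set J := (\int[mu]_(x in `[0%R, +oo[) _)%E.
have cE : continuous (fun x : R => expR (- (`|x| `^ b / 2))).
  apply/continuous_expRT/continuous_oppT/continuous_mulT.
    exact: continuous_norm_powR.
  exact: continuous_cstT.
have J0 : (0 < J)%E.
  apply: (@lt_le_trans _ _ (\int[mu]_(x in `[0%R, 1%R]) (expR (- (2^-1)))%:E)%E).
    by rewrite integral_cst//= lebesgue_measure_itv/= lte01 -EFinB -EFinM lte_fin subr0 mulr1 expR_gt0.
  apply: (@le_trans _ _ (\int[mu]_(x in `[0%R, 1%R]) (expR (- (`|x| `^ b / 2)))%:E)%E).
    apply: ge0_le_integral => //.
    - exact: continuous_measurable_EFin.
    - move=> x /=; rewrite in_itv/= => /andP[x0 x1]; rewrite lee_fin ler_expR lerN2.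
      rewrite ler_piMl ?invr_ge0// ger0_norm//.
      have <- : 1 `^ b = 1 :> R by rewrite powR1.
      by apply: ge0_ler_powR; rewrite ?nnegrE ?(ltW b0).
  apply: ge0_subset_integral => //.
  - exact: continuous_measurable_EFin.
  - by move=> x /=; rewrite !in_itv/= => /andP[-> _].
have Jy : (J < +oo)%E.
  pose C := (2 * (a + 1)) `^ (a + 1).
  apply: (@le_lt_trans _ _ (C%:E * \int[mu]_(x in `[0%R, +oo[)
     ((1 + 1 * `|x| `^ b) `^ (- (a + 1)) *
       expR (- (0 * `|x| `^ b / (1 + 1 * `|x| `^ b))))%:E)%E); last first.
    rewrite integral_rational_exp//.
    under eq_integral do rewrite !mul0r oppr0 expR0.
    by rewrite integral_cst//= lebesgue_measure_itv/= lte01 -EFinB -!EFinM ltry.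
  have d0 (x : R) : 0 < 1 + `|x| `^ b by rewrite ltr_pwDl// powR_ge0.
  have cP : continuous (fun x : R => (1 + `|x| `^ b) `^ (- (a + 1))).
    apply: continuous_powRT => //.
    by apply: continuous_addT; [exact: continuous_cstT|exact: continuous_norm_powR].
  under [X in (_ <= _ * X)%E]eq_integral do rewrite mul1r !mul0r oppr0 expR0 mulr1.
  rewrite -ge0_integralZl//; last 2 first.
  - exact: continuous_measurable_EFin.
  - by rewrite lee_fin powR_ge0.
  apply: ge0_le_integral => //.
  - exact: continuous_measurable_EFin.
  - apply: measurable_funeM.
    exact: continuous_measurable_EFin.
  - by move=> x _; rewrite -EFinM lee_fin expR_powR_bound// powR_ge0.
exists (fine J); first by rewrite fine_gt0// J0.
by rewrite fineK// ge0_fin_numE// ltW.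
Qed.

(** Substitute [q^a x] for [x], using [(q^a x)^b = q x^b]. With [q = |mu|^2] this writes the
    harmonic prior as a mixture of Gaussians. *)
Lemma integral_expR_scale (q : R) : 0 < q ->
  (\int[mu]_(x in `[0%R, +oo[) (expR (- (q * `|x| `^ b / 2)))%:E =
   (q `^ (- a))%:E *
   \int[mu]_(x in `[0%R, +oo[) (expR (- (`|x| `^ b / 2)))%:E)%E.
Proof.
move=> q0.
have qa0 : 0 < q `^ a by rewrite powR_gt0.
have dF (x : R) : is_derive x 1 (fun x : R => q `^ a * x) (q `^ a).
  by apply: (is_derive_eq (is_derive_scaleR _ (is_derive_id _ _))); rewrite mulr1.
have F' : (fun x : R => q `^ a * x)^`()%classic = fun=> q `^ a.
  by apply/funext => x; rewrite derive1E; have [_ ->] := dF x.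
have cE : continuous (fun x : R => expR (- (`|x| `^ b / 2))).
  apply/continuous_expRT/continuous_oppT/continuous_mulT.
    exact: continuous_norm_powR.
  exact: continuous_cstT.
have := @increasing_ge0_integration_by_substitutiony R (fun x => q `^ a * x)
  (fun x : R => expR (- (`|x| `^ b / 2))) 0.
rewrite F' mulr0 => -> //; first last.
- exact: continuous_subspaceT.
- by apply: gt0_cvgMry => //; exact: cvg_id.
- split; first by move=> x _; have [] := dF x.
  by apply: cvg_at_right_filter; exact: (is_derive_continuous (dF 0)).
- exact: is_cvg_cst.
- exact: is_cvg_cst.
- by move=> x _; exact: cvg_cst.
- by move=> x y _ _ xy; rewrite ltr_pM2l.
rewrite -ge0_integralZl//; last 3 first.
- apply: continuous_measurable_EFin.
  apply: continuous_mulT; last exact: continuous_cstT.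
  apply: (@continuousT_comp R (fun x => q `^ a * x)) cE.
  by move=> x; exact: (is_derive_continuous (dF x)).
- by move=> x _; rewrite lee_fin mulr_ge0 ?expR_ge0// powR_ge0.
- by rewrite lee_fin powR_ge0.
apply: eq_integral => x _; rewrite -EFinM; congr (_%:E) => /=.
rewrite !fctE powRN mulrCA mulVf ?gt_eqF// mulr1.
rewrite normrM (gtr0_norm qa0) powRM// ?(ltW qa0)// -powRrM mulfV ?gt_eqF//.
by rewrite powRr1 ?ltW.
Qed.
End radial.

(** * The marginal [mH] as a mixture of Gaussians *)

Section marginal.
Variable R : realType.
Local Notation mu := (@lebesgue_measure R).

(** At the origin the mixture diverges while [piH] takes a finite value, so the two integrands agree
    only elsewhere. Coordinate 0 is the innermost variable of [iint], hence discarding its single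
    point 0 in the last integral suffices. *)
Lemma eq_iint_off_hyperplane n (f g : (nat -> R) -> \bar R) : (0 < n)%N ->
  (forall y, measurable_fun setT
     (fun x : measurableTypeR R => f (fun i => if i == 0%N then x else y i))) ->
  (forall y, y 0%N != 0 -> f y = g y) -> iint n f = iint n g.
Proof.
case: n => // n _; elim: n f g => [|n IH] f g mf fg.
  pose f0 (x : R) := f (fun i => if i == 0%N then x else 0).
  pose g0 (x : R) := g (fun i => if i == 0%N then x else 0).
  have fg0 x : x \in [set: R] `\ 0 -> f0 x = g0 x.
    by rewrite inE /= => -[_ /eqP x0]; exact: fg.
  have mT : measurable ([set: measurableTypeR R] `\ 0) by exact: measurableD.
  have mf0 : measurable_fun ([set: measurableTypeR R] `\ 0) f0.
    by apply: measurable_funTS; exact: (mf (fun=> 0)).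
  have mg0 := eq_measurable_fun f0 fg0 mf0.
  transitivity (\int[mu]_x f0 x)%E; first by [].
  rewrite -(integral_setD1 mT mf0); apply: etrans (integral_setD1 mT mg0).
  by apply: eq_integral => x xT; exact: fg0.
have iintS k (h : (nat -> R) -> \bar R) : iint k.+1 h =
  (\int[mu]_x iint k (fun y => h (fun i => if i == k then x else y i)))%E by [].
rewrite (iintS _ f) (iintS _ g); apply: eq_integral => z _; apply: IH => y.
  have := mf (fun i => if i == n.+1 then z else y i).
  apply: eq_measurable_fun => x _; congr f; apply/funext => i.
  by case: eqP => // ->.
by move=> y0; exact: fg.
Qed.

Lemma integral_indicM (k : R) (D : set (measurableTypeR R)) (P : R -> R) :
  (\int[mu]_x (k * \1_D x * P x)%:E = \int[mu]_(x in D) (k * P x)%:E)%E.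
Proof.
rewrite [RHS]integral_mkcond; apply: eq_integral => x _.
by rewrite patchE indicE; case: (x \in D); rewrite ?mulr1 ?mulr0 ?mul0r.
Qed.

Lemma continuous_gauss1 (s m : R) : continuous (fun x => gauss1 s (x - m)).
Proof.
have cB : continuous (fun x : R => x - m).
  by apply: continuous_addT; [move=> x; exact: cvg_id|exact: continuous_cstT].
apply: continuous_mulT; first exact: continuous_cstT.
apply/continuous_expRT; apply: continuous_mulT; last exact: continuous_cstT.
by apply: continuous_oppT; apply: (@continuousT_comp R _ (fun x => x ^+ 2)) => //;
  exact: exprn_continuous.
Qed.

Lemma gauss1_ge0 (s x : R) : 0 <= gauss1 s x.
Proof. by rewrite mulr_ge0 ?expR_ge0// invr_ge0 sqrtr_ge0. Qed.

Lemma enorm_sqr d (x : 'rV[R]_d) : enorm x ^+ 2 = \sum_(i < d) x ord0 i ^+ 2.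
Proof. by rewrite sqr_sqrtr// sumr_ge0// => i _; rewrite sqr_ge0. Qed.

Lemma phi_prod d (x : 'rV[R]_d) (s : R) :
  phi x s = \prod_(i < d) gauss1 s (x ord0 i).
Proof.
rewrite /phi enorm_sqr big_split /= prodr_const card_ord exprVn; congr (_ * _).
rewrite -expR_sum; congr expR.
by rewrite -mulr_suml sumrN.
Qed.

Lemma piH_powR d (x : 'rV[R]_d) : (2 <= d)%N ->
  piH x = (\sum_(i < d) x ord0 i ^+ 2) `^ (- ((d%:R - 2) / 2)).
Proof.
move=> d2; rewrite /piH /enorm; set q := \sum_(i < d) _.
have q0 : 0 <= q by rewrite sumr_ge0// => i _; rewrite sqr_ge0.
rewrite powRN -powR12_sqrt// -powR_mulrn ?powR_ge0// -powRrM.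
by congr ((_ `^ _)^-1); rewrite natrB// mulrC.
Qed.

Section formula.
Variables (d : nat) (v : R).
Hypotheses (d3 : (3 <= d)%N) (v0 : 0 < v).
Let a : R := (d%:R - 2) / 2.
Let b := a^-1.
Let a0 : 0 < a.
Proof. by rewrite divr_gt0// subr_gt0 (ltr_nat R 2 d). Qed.
Let b0 : 0 < b. Proof. by rewrite invr_gt0. Qed.

(** Write the prior as a mixture, exchange the integrals, integrate each coordinate of [mu], and map
    the scale to [[0, 1]] by [F]. *)
Lemma mH_eq_scale_mixture : exists2 C : R, 0 < C & forall w : 'rV[R]_d,
  mH w v = C * \int[mu]_(x in `[0%R, 1%R])
    expR (- (enorm w ^+ 2 / (2 * v) * `|x| `^ b)).
Proof.
have [K K0 HK] := integral_expR_fin_gt0 a0.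
exists (K^-1 * v `^ (- a)); first by rewrite mulr_gt0 ?invr_gt0// powR_gt0.
move=> w.
pose o : 'I_d := Ordinal (ltn_trans (isT : (0 < 2)%N) d3).
pose W (i : nat) : R := w ord0 (insubd o i).
pose h (i : nat) (x y : R) : R :=
  gauss1 v (y - W i) *
  expR (- (`|x| `^ b * (1 * y + 0) ^+ 2 / 2)).
pose H (i : nat) (x : R) : R :=
  (Num.sqrt (1 + v * `|x| `^ b * 1 ^+ 2))^-1 *
  expR (- (`|x| `^ b * (1 * W i + 0) ^+ 2 /
     (2 * (1 + v * `|x| `^ b * 1 ^+ 2)))).
(* [iint_prod] integrates over the whole space, so the half-line enters through an indicator in the
   weight. *)
pose c (x : R) : R := K^-1 * \1_(`[0%R, +oo[ : set (measurableTypeR R)) x.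
have step1 : intRd (fun m => (phi (w - m) v * piH m)%:E) =
   iint d (fun y => \int[mu]_x (c x * \prod_(i < d) h i x (y i))%:E)%E.
  transitivity (iint d (fun y => (\prod_(i < d) gauss1 v (y i - W i) *
      (\sum_(i < d) y i ^+ 2) `^ (- a))%:E)).
    apply: eq_iint => y; rewrite phi_prod piH_powR ?(ltnW d3)//; congr (_%:E).
    congr (_ * _); last first.
      by congr (_ `^ _); apply: eq_bigr => i _; rewrite !mxE.
    by apply: eq_bigr => i _; rewrite !mxE /gauss1 /W valKd -sqrrN opprB.
  apply: eq_iint_off_hyperplane; first exact: ltn_trans d3.
    move=> y; apply/measurable_EFinP.
    have my (i : 'I_d) : measurable_fun [set: measurableTypeR R]
        (fun x : R => if i == 0%N :> nat then x else y i).
      by case: (i == 0%N :> nat); [exact: measurable_id|exact: measurable_cst].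
    apply: measurable_funM.
      apply: (@measurable_prod _ _ _ _ _ (index_enum _)
        (fun (i : 'I_d) x => gauss1 v ((if i == 0%N :> nat then x else y i) - W i))).
      move=> i _; have mg := continuous_measurable_fun (@continuous_gauss1 v (W i)).
      exact: (measurableT_comp mg (my i)).
    apply: (@measurableT_comp _ _ _ _ _ _ (fun z : R => z `^ (- a))).
      exact: measurable_powR.
    apply: (@measurable_sum _ _ _ _ _ (index_enum _)
        (fun (i : 'I_d) x => (if i == 0%N :> nat then x else y i) ^+ 2)) => i.
    by apply: measurable_funX; exact: my.
  move=> y y0; set q := \sum_(i < d) _.
  have q0 : 0 < q.
    rewrite /q (bigD1 o)//= ltr_pwDl//; first by rewrite exprn_even_gt0.
    by apply: sumr_ge0 => i _; rewrite sqr_ge0.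
  rewrite integral_indicM.
  transitivity (\int[mu]_(x in `[0%R, +oo[)
    ((K^-1 * \prod_(i < d) gauss1 v (y i - W i))%:E * (expR (- (q * `|x| `^ b / 2)))%:E))%E.
    rewrite ge0_integralZl//; last 2 first.
    - apply: continuous_measurable_EFin.
      apply/continuous_expRT/continuous_oppT/continuous_mulT.
        apply: continuous_mulT; first exact: continuous_cstT.
        exact: continuous_norm_powR.
      exact: continuous_cstT.
    - rewrite lee_fin mulr_ge0 ?invr_ge0 ?(ltW K0)// prodr_ge0// => i _.
      exact: gauss1_ge0.
    rewrite integral_expR_scale// HK -!EFinM; congr (_%:E).
    by field; rewrite gt_eqF.
  apply: eq_integral => x _; rewrite -EFinM; congr (_%:E).
  rewrite -[LHS]mulrA; congr (_ * _).
  rewrite /h [RHS]big_split /=; congr (_ * _).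
  rewrite -expR_sum; congr expR; rewrite sumrN; congr (- _).
  rewrite /q mulr_suml mulr_suml; apply: eq_bigr => i _.
  by rewrite mul1r addr0 [_ ^+ 2 * _]mulrC.
have mpow : measurable_fun setT (fun x : measurableTypeR R => `|x| `^ b).
  exact: (continuous_measurable_fun (continuous_norm_powR b0)).
have D0 (x : R) : 0 < 1 + v * `|x| `^ b.
  by rewrite ltr_pwDl// mulr_ge0 ?powR_ge0// ltW.
have cD : continuous (fun x : R => 1 + v * `|x| `^ b).
  apply: continuous_addT; first exact: continuous_cstT.
  by apply: continuous_mulT; [exact: continuous_cstT|exact: continuous_norm_powR].
have step2 : iint d (fun y => \int[mu]_x (c x * \prod_(i < d) h i x (y i))%:E)%E =
  (\int[mu]_x (c x * \prod_(i < d) H i x)%:E)%E.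
  apply: iint_prod.
  - by move=> x; rewrite mulr_ge0 ?invr_ge0 ?(ltW K0)// indicE.
  - by apply: measurable_funM; [exact: measurable_cst|exact: measurable_indic].
  - by move=> i x y; rewrite mulr_ge0 ?gauss1_ge0 ?expR_ge0.
  - move=> i; apply: measurable_funM.
      have mg := continuous_measurable_fun (@continuous_gauss1 v (W i)).
      exact: (measurableT_comp mg (@measurable_snd _ _ R R)).
    apply: measurableT_comp; first exact: measurable_expR.
    apply: measurable_funN; apply: measurable_funM; last exact: measurable_cst.
    apply: measurable_funM; first exact: (measurableT_comp mpow (@measurable_fst _ _ R R)).
    apply: measurable_funX; apply: measurable_funD; last exact: measurable_cst.
    by apply: measurable_funM; [exact: measurable_cst|exact: measurable_snd].
  - move=> i; apply: continuous_measurable_fun.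
    rewrite /H expr1n; under eq_fun do rewrite !mulr1.
    apply: continuous_mulT.
      apply: continuous_invT => [|x]; last by rewrite gt_eqF ?sqrtr_gt0.
      by apply: continuousT_comp; [exact: cD|exact: sqrt_continuous].
    apply/continuous_expRT/continuous_oppT/continuous_mulT.
      by apply: continuous_mulT; [exact: continuous_norm_powR|exact: continuous_cstT].
    apply: continuous_invT => [|x]; last by rewrite gt_eqF ?mulr_gt0.
    by apply: continuous_mulT; [exact: continuous_cstT|exact: cD].
  - by move=> i x; rewrite integral_gauss1_expR// powR_ge0.
rewrite /mH step1 step2.
have step3 : (\int[mu]_x (c x * \prod_(i < d) H i x)%:E)%E =
  (K^-1%:E * \int[mu]_(x in `[0%R, +oo[) ((1 + v * `|x| `^ b) `^ (- (a + 1)) *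
     expR (- (enorm w ^+ 2 / 2 * `|x| `^ b / (1 + v * `|x| `^ b))))%:E)%E.
  rewrite integral_indicM -ge0_integralZl//; last 3 first.
  - apply: continuous_measurable_EFin.
    apply: continuous_mulT; first exact: continuous_powRT.
    apply/continuous_expRT/continuous_oppT/continuous_mulT.
      by apply: continuous_mulT; [exact: continuous_cstT|exact: continuous_norm_powR].
    by apply: continuous_invT => // x; rewrite gt_eqF.
  - by move=> x _; rewrite lee_fin mulr_ge0 ?powR_ge0 ?expR_ge0.
  - by rewrite lee_fin invr_ge0 ltW.
  apply: eq_integral => x _; rewrite -EFinM; congr (_%:E); congr (_ * _).
  (* The [d] inverse square roots multiply to the power [-d/2], and [d/2 = a + 1]. *)
  rewrite /H big_split /= expr1n !mulr1 prodr_const card_ord; congr (_ * _).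
    rewrite exprVn -powR12_sqrt ?(ltW (D0 x))// -powR_mulrn ?powR_ge0// -powRrM powRN.
    by congr ((_ `^ _)^-1); rewrite /a; field.
  rewrite -expR_sum sumrN; congr (expR (- _)).
  rewrite enorm_sqr !mulr_suml; apply: eq_bigr => i _.
  rewrite /W valKd; field.
  by rewrite gt_eqF.
rewrite step3 integral_rational_exp// -/b.
have cE : continuous (fun x : R => expR (- (enorm w ^+ 2 / 2 / v * `|x| `^ b))).
  apply/continuous_expRT/continuous_oppT/continuous_mulT.
    exact: continuous_cstT.
  exact: continuous_norm_powR.
rewrite muleA -EFinM fineM//; last first.
  apply: integrable_fin_num => //.
  apply: continuous_compact_integrable; first exact: segment_compact.
  exact: continuous_subspaceT.
congr (_ * _); apply: eq_Rintegral => x _; congr expR.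
by rewrite invfM mulrA.
Qed.

End formula.
End marginal.

(** * The law of a sum of independent copies of [p X], with [X] uniform on [[0, 1]] *)

Section convolution.
Variable R : realType.
Local Notation mu := (@lebesgue_measure R).
Local Notation T := (measurableTypeR R).

Local Notation U := (uniform_prob (@ltr01 R) : probability T R).

(** Passing to the uniform probability gives an integral over the whole space, the form in which
    Tonelli's theorem is applied below. *)
Lemma integral01_uniform (f : T -> \bar R) : measurable_fun [set: T] f ->
  (forall x, 0 <= f x)%E ->
  (\int[mu]_(x in `[0%R, 1%R]) f x = \int[U]_x f x)%E.
Proof. by move=> mf f0; rewrite integral_uniform//= subr0 invr1 mul1e. Qed.

(** [Q] is the image of the product of [P] and the uniform law under [(s, x) |-> s + p x]. *)
Lemma exists_uniform_convolution (p : R -> R) (P : probability T R) :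
  continuous p ->
  exists Q : probability T R, forall f : T -> \bar R,
    measurable_fun [set: T] f -> (forall x, 0 <= f x)%E ->
    (\int[Q]_s f s = \int[P]_s \int[mu]_(x in `[0%R, 1%R]) f (s + p x)%R)%E.
Proof.
move=> cp.
pose X (z : T * T) : T := z.1 + p z.2.
have mX : measurable_fun [set: T * T] X.
  apply: measurable_funD; first exact: measurable_fst.
  exact: (measurableT_comp (continuous_measurable_fun cp) (@measurable_snd _ _ T T)).
pose XM : {mfun (T * T)%type >-> T} := HB.pack X (isMeasurableFun.Build _ _ _ _ X mX).
exists (distribution (P \x U)%E XM) => f mf f0.
have mfX : measurable_fun [set: T * T] (f \o X) by exact: measurableT_comp.
rewrite ge0_integral_pushforward// preimage_setT fubini_tonelli1//; last by move=> z; exact: f0.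
apply: eq_integral => s _; rewrite /fubini_F.
have mfs : measurable_fun [set: T] (fun x => (f \o X) (s, x)).
  exact: (measurable_fun_pair2 s mfX).
by rewrite integral_uniform//= subr0 invr1 mul1e.
Qed.


(** Iterating the convolution from the point mass at 0 makes [rho n] the law of the sum of [n]
    copies. The two integral identities are all that is used about it afterwards. *)
Lemma exists_uniform_convolution_powers (p : R -> R) : continuous p ->
  exists rho : nat -> probability T R,
    (forall f : T -> \bar R, measurable_fun [set: T] f -> (forall x, 0 <= f x)%E ->
       (\int[rho 0%N]_s f s = f 0%R)%E) /\
    (forall n (f : T -> \bar R),
       measurable_fun [set: T] f -> (forall x, 0 <= f x)%E ->
       (\int[rho n.+1]_s f s =
        \int[rho n]_s \int[mu]_(x in `[0%R, 1%R]) f (s + p x)%R)%E).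
Proof.
move=> cp; have [S HS] := choice (fun P => exists_uniform_convolution P cp).
exists (fun n => iter n S (\d_(0 : T))); split => [f mf f0|n f mf f0].
  by rewrite /= integral_dirac//= diracE mem_set// mul1e.
exact: HS.
Qed.

Section powers.
Variables (p : R -> R) (rho : nat -> probability T R).
Hypothesis cp : continuous p.
Hypothesis p01 : forall x, 0 <= x <= 1 -> 0 <= p x <= 1.
Hypothesis rho0 : forall f : T -> \bar R,
  measurable_fun [set: T] f -> (forall x, 0 <= f x)%E ->
  (\int[rho 0%N]_s f s = f 0%R)%E.
Hypothesis rhoS : forall n (f : T -> \bar R),
  measurable_fun [set: T] f -> (forall x, 0 <= f x)%E ->
  (\int[rho n.+1]_s f s = \int[rho n]_s \int[mu]_(x in `[0%R, 1%R]) f (s + p x)%R)%E.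

Definition average (f : R -> R) (s : R) : R := \int[mu]_(x in `[0, 1]) f (s + p x).

Let meas_shift (f : T -> \bar R) : measurable_fun [set: T] f ->
  measurable_fun [set: T * T] (fun z => f (z.1 + p z.2)).
Proof.
move=> mf; apply: (measurableT_comp mf).
apply: measurable_funD; first exact: measurable_fst.
exact: (measurableT_comp (continuous_measurable_fun cp) (@measurable_snd _ _ T T)).
Qed.

(** This expresses that [rho n] lives on [[0, n]], since each copy of [p] contributes at most 1. It
    is what makes arbitrary continuous functions integrable. *)
Lemma integral_rho_eq0 n (f : T -> \bar R) : measurable_fun [set: T] f ->
  (forall x, 0 <= f x)%E -> (forall x : R, 0 <= x <= n%:R -> f x = 0%E) ->
  (\int[rho n]_s f s = 0)%E.
Proof.
elim: n f => [|n IH] f mf f0 fn.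
  by rewrite rho0// fn ?lexx.
rewrite rhoS//; apply: IH.
- under eq_fun => s.
    rewrite integral01_uniform//; last exact: (measurable_fun_pair2 s (meas_shift mf)).
    over.
  by apply: (measurable_fun_fubini_tonelli_F (m2 := U) _ (meas_shift mf)) => z; exact: f0.
- by move=> x; apply: integral_ge0.
- move=> s /andP[s0 sn]; apply: integral0_eq => x /=; rewrite in_itv/= => x01.
  by apply: fn; have /andP[px0 px1] := p01 x01; rewrite addr_ge0//= -natr1 lerD.
Qed.

Lemma rho_integrable n (f : R -> R) : continuous f ->
  (rho n).-integrable [set: T] (EFin \o f).
Proof.
move=> cf.
have mf : measurable_fun [set: T] f by exact: continuous_measurable_fun.
have [B HB] : exists B, forall x : R, 0 <= x <= n%:R -> `|f x| <= B.
  have cn : {within `[0, n%:R], continuous (fun x => `|f x|)}.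
    apply: continuous_subspaceT; apply: (continuousT_comp cf).
    by move=> x; exact: norm_continuous.
  have [c _ Hc] := EVT_max (ler0n R n) cn.
  by exists `|f c| => x xn; apply: Hc; rewrite in_itv.
apply/integrableP; split; first exact/measurable_EFinP.
(* [|f|] is at most the constant [B] plus the excess [g], and [g] vanishes on [[0, n]]. *)
pose g x := Num.max 0 (`|f x| - B).
have mg : measurable_fun [set: T] g.
  apply: measurable_maxr; first exact: measurable_cst.
  by apply: measurable_funB; [exact: measurableT_comp|exact: measurable_cst].
have gf x : `|f x| <= B + g x by rewrite -lerBlDl le_max lexx orbT.
have B0 : 0 <= B by apply: le_trans (HB 0 _) => //; rewrite lexx/=.
apply: (@le_lt_trans _ _ (\int[rho n]_x (B%:E + (g x)%:E))%E).
  apply: ge0_le_integral => //=.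
  - by apply/measurable_EFinP; apply: measurableT_comp.
  - by apply: emeasurable_funD; [exact: measurable_cst|exact/measurable_EFinP].
  - by move=> x _; rewrite lee_fin.
rewrite ge0_integralD//; last 2 first.
- by move=> x _; rewrite lee_fin le_max lexx.
- exact/measurable_EFinP.
rewrite integral_cst//= (integral_rho_eq0 (f := EFin \o g)).
- by rewrite adde0 probability_setT mule1 ltry.
- exact/measurable_EFinP.
- by move=> x; rewrite lee_fin le_max lexx.
- move=> x xn; congr (_%:E); apply/max_idPl; rewrite subr_le0; exact: HB.
Qed.

(** The difference [|f| - f] is nonnegative and vanishes on the support, so [f] and [|f|] have the
    same integral. *)
Lemma Rintegral_rho_ge0 n (f : R -> R) : continuous f ->
  (forall x : R, 0 <= x <= n%:R -> 0 <= f x) -> 0 <= \int[rho n]_s f s.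
Proof.
move=> cf f0.
have ca : continuous (fun x => `|f x|).
  by apply: (continuousT_comp cf) => x; exact: norm_continuous.
suff : \int[rho n]_s (`|f s| - f s) = 0.
  rewrite RintegralB//; [|exact: rho_integrable..].
  by move=> /eqP; rewrite subr_eq0 => /eqP <-; apply: Rintegral_ge0.
have cb : continuous (fun x => `|f x| - f x).
  by apply: continuous_addT => //; exact: continuous_oppT.
rewrite /Rintegral (integral_rho_eq0 (f := fun s => (`|f s| - f s)%:E))//.
- exact: continuous_measurable_EFin.
- by move=> x; rewrite lee_fin subr_ge0 ler_norm.
- by move=> x xn; rewrite ger0_norm ?subrr// f0.
Qed.

Lemma le_Rintegral_rho n (f g : R -> R) : continuous f -> continuous g ->
  (forall x : R, 0 <= x <= n%:R -> f x <= g x) ->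
  \int[rho n]_s f s <= \int[rho n]_s g s.
Proof.
move=> cf cg fg; rewrite -subr_ge0 -RintegralB//; [|exact: rho_integrable..].
apply: Rintegral_rho_ge0 => [|x xn]; last by rewrite subr_ge0 fg.
by apply: continuous_addT => //; exact: continuous_oppT.
Qed.

Lemma eq_Rintegral_rho n (f g : R -> R) : continuous f -> continuous g ->
  (forall x : R, 0 <= x <= n%:R -> f x = g x) ->
  \int[rho n]_s f s = \int[rho n]_s g s.
Proof.
move=> cf cg fg; apply/eqP; rewrite eq_le.
by rewrite !le_Rintegral_rho// => x xn; rewrite fg.
Qed.

Lemma continuous_translate (f : R -> R) (c : R) : continuous f ->
  continuous (fun x => f (x + c)).
Proof.
move=> cf; apply: (@continuousT_comp R (fun x => x + c)) cf.
by apply: continuous_addT; [move=> x; exact: cvg_id|exact: continuous_cstT].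
Qed.

Lemma continuous_addl_comp (f g : R -> R) (c : R) : continuous f -> continuous g ->
  continuous (fun x => f (c + g x)).
Proof.
move=> cf cg; apply: (@continuousT_comp R (fun x => c + g x)) cf.
by apply: continuous_addT => //; exact: continuous_cstT.
Qed.

Lemma continuous_integrable01 (f : R -> R) : continuous f ->
  mu.-integrable `[0, 1] (EFin \o f).
Proof.
move=> cf; apply: continuous_compact_integrable; first exact: segment_compact.
exact: continuous_subspaceT.
Qed.

Lemma continuous_average_weighted (q f : R -> R) : continuous q -> continuous f ->
  continuous (fun s => \int[mu]_(x in `[0, 1]) (q x * f (s + p x))).
Proof.
move=> cq cf s.
(* This window contains [z + p x] whenever [z] is within 1 of [s], so [C * B] dominates the
   integrand there. *)
have [B HB] : exists B, forall y : R, s - 1 <= y <= s + 2 -> `|f y| <= B.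
  have cn : {within `[s - 1, s + 2], continuous (fun x => `|f x|)}.
    apply: continuous_subspaceT; apply: (continuousT_comp cf).
    by move=> x; exact: norm_continuous.
  have s12 : s - 1 <= s + 2 by lra.
  have [c _ Hc] := EVT_max s12 cn.
  by exists `|f c| => x xn; apply: Hc; rewrite in_itv.
have [C HC] : exists B, forall y : R, 0 <= y <= 1 -> `|q y| <= B.
  have cn : {within `[0, 1], continuous (fun x => `|q x|)}.
    apply: continuous_subspaceT; apply: (continuousT_comp cq).
    by move=> x; exact: norm_continuous.
  have [c _ Hc] := EVT_max (@ler01 R) cn.
  by exists `|q c| => x xn; apply: Hc; rewrite in_itv.
apply: (@continuity_under_integral R _ _ mu (fun s x => q x * f (s + p x))
  `[0, 1] _ (s - 1) (s + 1) _ _ (cst (C * B))).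
- by [].
- move=> y _; apply: continuous_integrable01; apply: continuous_mulT => //.
  exact: continuous_addl_comp.
- apply: aeW => y _ z _; apply: continuous_mulT; first exact: continuous_cstT.
  exact: continuous_translate.
- by apply: continuous_integrable01; exact: continuous_cstT.
- move=> y /=; rewrite in_itv/= => y1; apply: aeW => z /=; rewrite in_itv/= => z01.
  rewrite normrM ler_pM// ?HC// HB//.
  have := p01 z01; lra.
- by rewrite inE/= in_itv/=; apply/andP; split; lra.
Qed.

Lemma continuous_average (f : R -> R) : continuous f -> continuous (average f).
Proof.
move=> cf.
have -> : average f = fun s => \int[mu]_(x in `[0, 1]) (1 * f (s + p x)).
  by apply/funext => s; apply: eq_Rintegral => x _; rewrite mul1r.
by apply: (continuous_average_weighted (q := fun=> 1)) => //; exact: continuous_cstT.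
Qed.

Let Rintegral_rhoS_ge0 n (f : R -> R) : continuous f -> (forall x, 0 <= f x) ->
  \int[rho n.+1]_s f s = \int[rho n]_s average f s.
Proof.
move=> cf f0; congr fine.
rewrite rhoS//=; last exact: continuous_measurable_EFin.
apply: eq_integral => s _; rewrite /average /Rintegral fineK//.
apply: integrable_fin_num => //; apply: continuous_integrable01.
exact: continuous_addl_comp.
Qed.

Lemma Rintegral_rhoS n (f : R -> R) : continuous f ->
  \int[rho n.+1]_s f s = \int[rho n]_s average f s.
Proof.
move=> cf.
have ca : continuous (fun x => `|f x|).
  by apply: (continuousT_comp cf) => x; exact: norm_continuous.
(* The signed case follows by subtracting the nonnegative case for [|f|] from the one for
   [|f| + f]. *)
have cs : continuous (fun x => `|f x| + f x) by exact: continuous_addT.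
have s0 x : 0 <= `|f x| + f x by rewrite -lerBlDr sub0r -normrN ler_norm.
have := Rintegral_rhoS_ge0 n cs s0.
rewrite RintegralD//; [|exact: rho_integrable..].
rewrite (Rintegral_rhoS_ge0 n ca)//.
rewrite (_ : average (fun x => `|f x| + f x) =
   fun s => average (fun x => `|f x|) s + average f s); last first.
  apply/funext => s; rewrite /average RintegralD//.
    by apply: continuous_integrable01; exact: (continuous_addl_comp (c := s) ca cp).
  by apply: continuous_integrable01; exact: (continuous_addl_comp (c := s) cf cp).
rewrite RintegralD//; [|exact/rho_integrable/continuous_average..].
by move=> /addrI.
Qed.

Lemma Rintegral_rho0 (f : R -> R) : continuous f -> \int[rho 0%N]_s f s = f 0.
Proof.
move=> cf; rewrite (@eq_Rintegral_rho 0 f (fun=> f 0))//.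
- by rewrite Rintegral_cst//= probability_setT/= mulr1.
- exact: continuous_cstT.
- by move=> x x0; congr f; apply/eqP; rewrite eq_le andbC.
Qed.

Lemma Rintegral_swap01 (P : probability T R) (h : R -> R -> R) :
  (forall s x, 0 <= h s x) ->
  measurable_fun [set: T * T] (fun z => h z.1 z.2) ->
  (forall s, mu.-integrable `[0, 1] (EFin \o h s)) ->
  (forall x, P.-integrable [set: T] (EFin \o h^~ x)) ->
  \int[P]_s \int[mu]_(x in `[0, 1]) h s x =
  \int[mu]_(x in `[0, 1]) \int[P]_s h s x.
Proof.
move=> h0 mh i1 i2.
have mhE : measurable_fun [set: T * T] (fun z => (h z.1 z.2)%:E).
  exact/measurable_EFinP.
have hE0 (z : T * T) : (0 <= (h z.1 z.2)%:E)%E by rewrite lee_fin.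
have ms s := measurable_fun_pair2 s mhE.
rewrite [LHS]/Rintegral [RHS]/Rintegral; congr fine.
transitivity (\int[P]_s \int[U]_x (h s x)%:E)%E.
  apply: eq_integral => s _; rewrite /Rintegral fineK; last first.
    by apply: integrable_fin_num => //; exact: i1.
  by rewrite integral01_uniform//; [exact: ms|move=> x; rewrite lee_fin].
rewrite (fubini_tonelli (m1 := P) (m2 := U) _ mhE hE0) /=.
rewrite -integral01_uniform.
- apply: eq_integral => x _; rewrite /Rintegral fineK//.
  by apply: integrable_fin_num => //; exact: i2.
- exact: (measurable_fun_fubini_tonelli_G (m1 := P) _ mhE hE0).
- by move=> x; apply: integral_ge0 => s _; rewrite lee_fin.
Qed.

(** By Tonelli, the integral of the inner integrals is the same in either order, so finiteness
    transfers. *)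
Lemma integrable_swap01 (P : probability T R) (h : R -> R -> R) :
  (forall s x, 0 <= h s x) ->
  measurable_fun [set: T * T] (fun z => h z.1 z.2) ->
  (forall s, mu.-integrable `[0, 1] (EFin \o h s)) ->
  (forall x, P.-integrable [set: T] (EFin \o h^~ x)) ->
  P.-integrable [set: T] (EFin \o (fun s => \int[mu]_(x in `[0, 1]) h s x)) ->
  mu.-integrable `[0, 1] (EFin \o (fun x => \int[P]_s h s x)).
Proof.
move=> h0 mh i1 i2 /integrableP[_ i3].
have mhE : measurable_fun [set: T * T] (fun z => (h z.1 z.2)%:E).
  exact/measurable_EFinP.
have hE0 (z : T * T) : (0 <= (h z.1 z.2)%:E)%E by rewrite lee_fin.
have ms s := measurable_fun_pair2 s mhE.
have E2 : EFin \o (fun x => \int[P]_s h s x) = (fun x => \int[P]_s (h s x)%:E)%E.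
  apply/funext => x; rewrite /= /Rintegral fineK//.
  by apply: integrable_fin_num => //; exact: i2.
have mG := measurable_fun_fubini_tonelli_G (m1 := P) _ mhE hE0.
have G0 x : (0 <= \int[P]_s (h s x)%:E)%E.
  by apply: integral_ge0 => s _; rewrite lee_fin.
rewrite E2; apply/integrableP; split; first exact: measurable_funTS mG.
under eq_integral => x _ do rewrite gee0_abs//.
rewrite integral01_uniform// -(fubini_tonelli (m1 := P) (m2 := U) _ mhE hE0) /=.
apply: le_lt_trans i3; rewrite le_eqVlt; apply/orP; left; apply/eqP.
apply: eq_integral => s _.
have h0s : (0 <= \int[mu]_(x in `[0%R, 1%R]) (h s x)%:E)%E.
  by apply: integral_ge0 => x _; rewrite lee_fin.
rewrite /= ger0_norm ?fine_ge0// /Rintegral fineK; last first.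
  by apply: integrable_fin_num => //; exact: i1.
by rewrite integral01_uniform//; [exact: ms|move=> x; rewrite lee_fin].
Qed.

Lemma integrable01_rho_shift n (f : R -> R) : continuous f -> (forall x, 0 <= f x) ->
  mu.-integrable `[0, 1] (EFin \o (fun x => \int[rho n]_s f (s + p x))).
Proof.
move=> cf f0; apply: (integrable_swap01 (h := fun s x => f (s + p x))).
- by move=> s x; exact: f0.
- apply: (measurableT_comp (continuous_measurable_fun cf)).
  apply: measurable_funD; first exact: measurable_fst.
  exact: (measurableT_comp (continuous_measurable_fun cp) (@measurable_snd _ _ T T)).
- by move=> s; apply: continuous_integrable01; exact: continuous_addl_comp.
- by move=> x; apply: rho_integrable; exact: continuous_translate.
- exact/rho_integrable/continuous_average.
Qed.

Lemma Rintegral_rho_average n (f : R -> R) : continuous f -> (forall x, 0 <= f x) ->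
  \int[rho n]_s average f s = \int[mu]_(x in `[0, 1]) \int[rho n]_s f (s + p x).
Proof.
move=> cf f0; apply: (Rintegral_swap01 (h := fun s x => f (s + p x))).
- by move=> s x; exact: f0.
- apply: (measurableT_comp (continuous_measurable_fun cf)).
  apply: measurable_funD; first exact: measurable_fst.
  exact: (measurableT_comp (continuous_measurable_fun cp) (@measurable_snd _ _ T T)).
- by move=> s; apply: continuous_integrable01; exact: continuous_addl_comp.
- by move=> x; apply: rho_integrable; exact: continuous_translate.
Qed.

Definition average_weighted (f : R -> R) (s : R) : R :=
  \int[mu]_(x in `[0, 1]) (p x * f (s + p x)).

(** Both sides are the expectation of [p X * f (s + p X + p Y)] for independent uniform [X] and [Y],
    up to the order of integration. *)
Lemma average_weighted_comm (f : R -> R) : continuous f -> (forall x, 0 <= f x) ->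
  average_weighted (average f) = average (average_weighted f).
Proof.
move=> cf f0; apply/funext => s.
have cpn : continuous (fun x => `|p x|).
  by apply: (continuousT_comp cp) => x; exact: norm_continuous.
have RU (g : R -> R) : continuous g -> (forall x, 0 <= g x) ->
    \int[mu]_(x in `[0, 1]) g x = \int[U]_x g x.
  move=> cg g0; rewrite /Rintegral integral01_uniform//.
  exact: continuous_measurable_EFin.
(* The absolute value keeps [h] nonnegative outside [[0, 1]] too, as the exchange of integrals
   asks. *)
pose h (x y : R) := `|p x| * f (s + p x + p y).
have h0 x y : 0 <= h x y by rewrite mulr_ge0.
have ch1 x : continuous (h x).
  by apply: continuous_mulT; [exact: continuous_cstT|exact: continuous_addl_comp].
have ch2 y : continuous (h^~ y).
  apply: continuous_mulT => //.
  apply: (@continuousT_comp R (fun x => s + p x + p y)) cf.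
  apply: continuous_addT; last exact: continuous_cstT.
  by apply: continuous_addT => //; exact: continuous_cstT.
have iU (g : R -> R) : continuous g -> (forall x, 0 <= g x) ->
   (U : probability T R).-integrable [set: T] (EFin \o g).
  move=> cg g0; apply/integrableP; split.
    exact: continuous_measurable_EFin.
  under eq_integral => x _ do rewrite /= ger0_norm//.
  rewrite -integral01_uniform//; last exact: continuous_measurable_EFin.
  have /integrableP[_] := continuous_integrable01 cg.
  by under eq_integral => x _ do rewrite /= ger0_norm//.
transitivity (\int[U]_x \int[mu]_(y in `[0, 1]) h x y).
  rewrite -RU.
  - apply: eq_Rintegral => x; rewrite inE/= in_itv/= => x01.
    have /andP[px0 _] := p01 x01.
    rewrite -RintegralZl//; last first.
      by apply: continuous_integrable01; exact: continuous_addl_comp.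
    by apply: eq_Rintegral => y _; rewrite /h ger0_norm.
  - have -> : (fun x => \int[mu]_(y in `[0, 1]) h x y) =
       fun x => `|p x| * average f (s + p x).
      apply/funext => x; rewrite /average -RintegralZl//.
      by apply: continuous_integrable01; exact: continuous_addl_comp.
    apply: continuous_mulT => //; apply: continuous_addl_comp => //.
    exact: continuous_average.
  - by move=> x; apply: Rintegral_ge0.
rewrite (Rintegral_swap01 (P := U))//; last 3 first.
- apply: measurable_funM.
    exact: (measurableT_comp (continuous_measurable_fun cpn) (@measurable_fst _ _ T T)).
  apply: (measurableT_comp (continuous_measurable_fun cf)).
  apply: measurable_funD; last first.
    exact: (measurableT_comp (continuous_measurable_fun cp) (@measurable_snd _ _ T T)).
  apply: measurable_funD; first exact: measurable_cst.
  exact: (measurableT_comp (continuous_measurable_fun cp) (@measurable_fst _ _ T T)).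
- by move=> x; exact: continuous_integrable01.
- by move=> y; exact: iU.
apply: eq_Rintegral => y _; rewrite -RU//; apply: eq_Rintegral => x.
rewrite inE/= in_itv/= => x01; have /andP[px0 _] := p01 x01.
by rewrite /h ger0_norm// addrAC.
Qed.

(** By symmetry every copy contributes equally to the factor [s]. The induction splits off the last
    copy and commutes [average_weighted] past [average]. *)
Lemma Rintegral_rho_id n (f : R -> R) : continuous f -> (forall x, 0 <= f x) ->
  \int[rho n.+1]_s (s * f s) = n.+1%:R * \int[rho n]_s average_weighted f s.
Proof.
have cid : continuous (fun x : R => x) by move=> x; exact: cvg_id.
have E (g : R -> R) s : continuous g ->
    average (fun s => s * g s) s = s * average g s + average_weighted g s.
  move=> cg; have cs : continuous (fun x => g (s + p x)) by exact: continuous_addl_comp.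
  rewrite /average /average_weighted.
  rewrite -RintegralZl//; last exact: continuous_integrable01.
  rewrite -RintegralD//; last 2 first.
  - by apply/continuous_integrable01/continuous_mulT => //; exact: continuous_cstT.
  - by apply/continuous_integrable01/continuous_mulT.
  by apply: eq_Rintegral => x _; rewrite mulrDl.
have cw (g : R -> R) : continuous g -> continuous (average_weighted g).
  by move=> cg; exact: continuous_average_weighted.
elim: n f => [|n IH] f cf f0.
  rewrite Rintegral_rhoS; last exact: continuous_mulT.
  rewrite !Rintegral_rho0 ?mul1r ?E ?mul0r ?add0r//; first exact: cw.
  by apply: continuous_average; exact: continuous_mulT.
rewrite Rintegral_rhoS; last exact: continuous_mulT.
under eq_Rintegral => s _ do rewrite (E f s cf).
have ca := continuous_average cf.
rewrite RintegralD//; last 2 first.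
- by apply/rho_integrable; exact: continuous_mulT.
- exact/rho_integrable/cw.
rewrite IH//; last by move=> x; apply: Rintegral_ge0.
rewrite average_weighted_comm// -Rintegral_rhoS; last exact: cw.
by rewrite -[in RHS]natr1 mulrDl mul1r.
Qed.

(** The Laplace transform of a sum of independent copies is multiplicative. Read from right to left,
    it expands the power of [mH]. *)
Lemma Rintegral_rho_exp n (q : R) :
  \int[rho n]_s expR (- (q * s)) = (\int[mu]_(x in `[0, 1]) expR (- (q * p x))) ^+ n.
Proof.
have ce (c : R) : continuous (fun x => expR (- (c * x))).
  apply/continuous_expRT/continuous_oppT/continuous_mulT.
    exact: continuous_cstT.
  by move=> x; exact: cvg_id.
elim: n => [|n IH].
  by rewrite Rintegral_rho0// mulr0 oppr0 expR0 expr0.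
rewrite Rintegral_rhoS//.
have E s : average (fun x => expR (- (q * x))) s =
    (\int[mu]_(x in `[0, 1]) expR (- (q * p x))) * expR (- (q * s)).
  rewrite -RintegralZr//; last first.
    apply: continuous_integrable01.
    exact: (@continuousT_comp R p (fun x => expR (- (q * x)))).
  by apply: eq_Rintegral => x _; rewrite -expRD; congr expR; ring.
under eq_Rintegral do rewrite E.
by rewrite RintegralZl ?IH ?exprS//; exact: rho_integrable.
Qed.

End powers.
End convolution.

(** * The weight left after integrating out [Z_1], and its monotonicity *)

Section kernel.
Variables (R : realType) (a tau r : R).
Hypotheses (a0 : 0 < a) (t0 : 0 <= tau) (r0 : 0 <= r).
Implicit Types l s : R.

(** In the overview's notation [kernel_arg] is kappa, and [kernel_weight] is the integrand of g with
    [a + 1 = d/2]. The absolute values extend all three continuously to the line. *)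
Definition kernel_den l : R := 1 + tau * `|l|.
Definition kernel_arg l : R := `|l| / kernel_den l.
Definition kernel_weight l : R := expR (- (r * kernel_arg l)) * kernel_den l `^ (- (a + 1)).

Lemma kernel_den_gt0 l : 0 < kernel_den l.
Proof. by rewrite ltr_pwDl// mulr_ge0. Qed.

Lemma kernel_den_neq0 l : kernel_den l != 0. Proof. by rewrite gt_eqF ?kernel_den_gt0. Qed.

Lemma kap_ge0 l : 0 <= kernel_arg l.
Proof. by rewrite divr_ge0// ltW// kernel_den_gt0. Qed.

Lemma kwt_gt0 l : 0 < kernel_weight l.
Proof. by rewrite mulr_gt0 ?expR_gt0// powR_gt0 ?kernel_den_gt0. Qed.

Lemma kwt_ge0 l : 0 <= kernel_weight l. Proof. exact: ltW (kwt_gt0 l). Qed.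

Lemma kap_kden l : kernel_arg l * kernel_den l = `|l|.
Proof. by rewrite divfK// kernel_den_neq0. Qed.

Lemma norm_kap l : `|l| = kernel_arg l + tau * (`|l| * kernel_arg l).
Proof. by rewrite -{1}kap_kden /kernel_den; ring. Qed.

Lemma continuous_norm : continuous (fun x : R => `|x|).
Proof. by move=> x; exact: norm_continuous. Qed.

Lemma continuous_kden : continuous kernel_den.
Proof.
apply: continuous_addT; first exact: continuous_cstT.
by apply: continuous_mulT; [exact: continuous_cstT|exact: continuous_norm].
Qed.

Lemma continuous_kap : continuous kernel_arg.
Proof.
apply: continuous_mulT; first exact: continuous_norm.
by apply: continuous_invT; [exact: continuous_kden|exact: kernel_den_neq0].
Qed.

Lemma continuous_kwt : continuous kernel_weight.
Proof.
apply: continuous_mulT.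
  apply/continuous_expRT/continuous_oppT/continuous_mulT.
    exact: continuous_cstT.
  exact: continuous_kap.
by apply: continuous_powRT; [exact: continuous_kden|exact: kernel_den_gt0].
Qed.

Lemma is_derive_norm l : 0 < l -> is_derive l 1 (fun x : R => `|x|) 1.
Proof.
move=> l0; have d1 : is_derive l 1 (fun x : R => x) 1 by exact: is_derive_id.
apply: is_derive_eq_near d1.
near=> y; rewrite /= ger0_norm//; apply: ltW; near: y; exact: lt_nbhsr.
Unshelve. all: by end_near. Qed.

Lemma is_derive_kden l : 0 < l -> is_derive l 1 kernel_den tau.
Proof.
move=> l0; apply: (is_derive_eq (is_derive_addR (is_derive_cstR 1 l)
  (is_derive_scaleR tau (is_derive_norm l0)))).
by rewrite add0r mulr1.
Qed.

Lemma is_derive_kwt l : 0 < l ->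
  is_derive l 1 kernel_weight (- (kernel_weight l * (r / kernel_den l ^+ 2 + (a + 1) * tau / kernel_den l))).
Proof.
move=> l0; have D0 := kernel_den_gt0 l.
have dk := is_derive_mulR (is_derive_norm l0)
  (is_derive_invR (is_derive_kden l0) (kernel_den_neq0 l)).
have de := is_derive_expRR (is_derive_oppR (is_derive_scaleR r dk)).
have dp := is_derive_powRR (- (a + 1)) (is_derive_kden l0) D0.
apply: (is_derive_eq (is_derive_mulR de dp)).
rewrite -/(kernel_arg l).
have -> : kernel_den l `^ (- (a + 1) - 1) = kernel_den l `^ (- (a + 1)) / kernel_den l.
  by rewrite powRB ?kernel_den_neq0 ?implybT// powRr1// ltW.
rewrite /kernel_weight; set e := expR _; set q := kernel_den l `^ _.
have Dn := kernel_den_neq0 l.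
have -> : 1 / kernel_den l + `|l| * (- tau / kernel_den l ^+ 2) = (kernel_den l ^+ 2)^-1.
  rewrite /kernel_den in Dn *; field; exact: Dn.
by field.
Qed.

(** This function is chosen for integration by parts: since [l / kernel_den l] is [kernel_arg l],
    multiplying the derivative by [l] produces the integrand of r M2. *)
Lemma is_derive_norm_kwt l : 0 < l ->
  is_derive l 1 (fun l => `|l| * kernel_weight l)
    (kernel_weight l - kernel_weight l * kernel_arg l * (r / kernel_den l + (a + 1) * tau)).
Proof.
move=> l0; apply: (is_derive_eq (is_derive_mulR (is_derive_norm l0) (is_derive_kwt l0))).
have Dn := kernel_den_neq0 l.
by rewrite -kap_kden; field.
Qed.

(** Likewise [l] times this derivative produces the integrand of r M1. The leading 0 fits the form
    [p1 - p2] in which parts are integrated later. *)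
Lemma is_derive_kden_kwt l : 0 < l ->
  is_derive l 1 (fun l => kernel_den l * kernel_weight l)
    (0 - kernel_weight l * (r / kernel_den l + a * tau)).
Proof.
move=> l0; apply: (is_derive_eq (is_derive_mulR (is_derive_kden l0) (is_derive_kwt l0))).
have Dn := kernel_den_neq0 l.
by field.
Qed.

Lemma ler_kden l l' : 0 <= l -> l <= l' -> kernel_den l <= kernel_den l'.
Proof.
move=> l0 ll'; rewrite /kernel_den !ger0_norm// ?(le_trans l0 ll')// lerD2l.
by rewrite ler_wpM2l.
Qed.

Lemma kap_sub l h : 0 <= l -> 0 <= h ->
  kernel_arg (l + h) - kernel_arg l = h / (kernel_den l * kernel_den (l + h)).
Proof.
move=> l0 h0; have := kernel_den_neq0 l; have := kernel_den_neq0 (l + h).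
rewrite /kernel_arg /kernel_den !ger0_norm ?addr_ge0// => D1 D2; field.
by rewrite D1 D2.
Qed.

Lemma ler_kap l l' : 0 <= l -> l <= l' -> kernel_arg l <= kernel_arg l'.
Proof.
move=> l0 ll'; have h0 : 0 <= l' - l by rewrite subr_ge0.
rewrite -subr_ge0 -(subrKC l l') kap_sub// divr_ge0// mulr_ge0// ltW ?kernel_den_gt0//.
Qed.

(** For [l >= 0], this quotient is the factor beside [l] in [kernel_arg l * kernel_weight l]. *)
Lemma ler_kwt_kden l l' : 0 <= l -> l <= l' -> kernel_weight l' / kernel_den l' <= kernel_weight l / kernel_den l.
Proof.
move=> l0 ll'.
have kk := ler_kden l0 ll'.
apply: ler_pM; rewrite ?invr_ge0 ?kwt_ge0 ?(ltW (kernel_den_gt0 _))//; last first.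
  by rewrite lef_pV2 ?posrE ?kernel_den_gt0.
apply: ler_pM; rewrite ?expR_ge0 ?powR_ge0//.
  by rewrite ler_expR lerN2 ler_wpM2l// ler_kap.
rewrite !powRN lef_pV2 ?posrE ?powR_gt0 ?kernel_den_gt0//.
by apply: ge0_ler_powR; rewrite ?nnegrE ?(ltW (kernel_den_gt0 _))// addr_ge0// ltW.
Qed.

(** Cross-multiplied form of the monotonicity in [s] of [kernel_den (s + 1) * kernel_weight (s + 1)
    / kernel_weight (s + lam)]. The exponentials compare because increments of [kernel_arg] shrink
    to the right ([kap_sub]). The powers are regrouped as [x^(-1) (x y)^(-a)], and the products
    [x y] differ by [tau^2 (s' - s) (1 - lam)]. *)
Lemma kwt_ratio s s' lam : 0 <= s -> s <= s' -> 0 <= lam <= 1 ->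
  kernel_weight (s' + lam) * (kernel_den (s + 1) * kernel_weight (s + 1)) <=
  kernel_weight (s + lam) * (kernel_den (s' + 1) * kernel_weight (s' + 1)).
Proof.
move=> s0 ss' /andP[lam0 lam1].
have s'0 := le_trans s0 ss'.
have h0 : 0 <= s' - s by rewrite subr_ge0.
have E l : kernel_den l * kernel_weight l = expR (- (r * kernel_arg l)) * kernel_den l `^ (- a).
  rewrite /kernel_weight mulrCA; congr (_ * _).
  rewrite -[X in X * _](powRr1 (ltW (kernel_den_gt0 l))) -powRD; last first.
    by rewrite kernel_den_neq0 implybT.
  by congr (_ `^ _); ring.
have D l := kernel_den_gt0 l.
rewrite !E /kernel_weight mulrACA [leRHS]mulrACA -!expRD.
apply: ler_pM; rewrite ?expR_ge0 ?mulr_ge0 ?powR_ge0//.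
  rewrite ler_expR -!opprD lerN2 -!mulrDr ler_wpM2l//.
  rewrite -subr_ge0; set X := (X in 0 <= X).
  have -> : X = (kernel_arg (s' + lam) - kernel_arg (s + lam)) - (kernel_arg (s' + 1) - kernel_arg (s + 1)).
    by rewrite /X; ring.
  rewrite subr_ge0.
  have -> : s' + 1 = s + 1 + (s' - s) by ring.
  have -> : s' + lam = s + lam + (s' - s) by ring.
  move: (s' - s) h0 => h h0.
  rewrite !kap_sub ?addr_ge0//.
  have k1 : kernel_den (s + lam) <= kernel_den (s + 1) by rewrite ler_kden ?addr_ge0// lerD2l.
  have k2 : kernel_den (s + lam + h) <= kernel_den (s + 1 + h).
    by apply: ler_kden; [exact: (addr_ge0 (addr_ge0 s0 lam0) h0)|rewrite lerD2r lerD2l].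
  rewrite ler_wpM2l// lef_pV2 ?posrE ?mulr_gt0//.
  by apply: ler_pM => //; rewrite ltW.
have P (x y : R) : 0 < x -> 0 < y ->
    x `^ (- (a + 1)) * y `^ (- a) = x^-1 * (x * y) `^ (- a).
  move=> x0 y0; rewrite powRM ?ltW// mulrA; congr (_ * _).
  rewrite -powR_inv1 ?ltW// -powRD ?(gt_eqF x0) ?implybT//.
  by congr (_ `^ _); ring.
rewrite !P//.
apply: ler_pM; rewrite ?invr_ge0 ?(ltW (D _)) ?powR_ge0//.
  by rewrite lef_pV2 ?posrE// ler_kden ?addr_ge0// lerD2r.
rewrite !powRN lef_pV2 ?posrE ?powR_gt0 ?mulr_gt0//.
apply: ge0_ler_powR; rewrite ?nnegrE ?mulr_ge0 ?(ltW (D _)) ?(ltW a0)//.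
rewrite /kernel_den !ger0_norm ?addr_ge0// -subr_ge0.
have -> : (1 + tau * (s' + lam)) * (1 + tau * (s + 1)) -
  (1 + tau * (s + lam)) * (1 + tau * (s' + 1)) =
  tau ^+ 2 * ((s' - s) * (1 - lam)) by ring.
by rewrite mulr_ge0 ?sqr_ge0// mulr_ge0// subr_ge0.
Qed.

End kernel.

(** * Integration by parts and the moment inequality *)

Section moment_inequality.
Variables (R : realType) (a : R).
Hypothesis a0 : 0 < a.
Local Notation mu := (@lebesgue_measure R).
Local Notation T := (measurableTypeR R).
Let b := a^-1.
Let b0 : 0 < b. Proof. by rewrite invr_gt0. Qed.
Let p (x : R) : R := `|x| `^ b.
Let cp : continuous p. Proof. exact: continuous_norm_powR. Qed.
Let p01 (x : R) : 0 <= x <= 1 -> 0 <= p x <= 1.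
Proof.
move=> /andP[x0 x1]; rewrite powR_ge0/=.
have <- : 1 `^ b = 1 :> R by rewrite powR1.
by apply: ge0_ler_powR; rewrite ?nnegrE ?(ltW b0)// ger0_norm.
Qed.
Let p1E : p 1 = 1. Proof. by rewrite /p normr1 powR1. Qed.

(** Fundamental theorem for [x * f (s + p x)] on [[0, 1]], with [x p'(x) = b p x]. The factor [x]
    kills the boundary term at 0, and [p 1 = 1] gives the one at 1. *)
Lemma average_by_parts (f f' : R -> R) (s : R) : continuous f -> continuous f' ->
  (forall l : R, 0 < l -> is_derive l 1 f (f' l)) -> 0 <= s ->
  average p f s + b * average_weighted p f' s = f (s + 1).
Proof.
move=> cf cf' df s0.
have c1 : continuous (fun x => f (s + p x)) by exact: continuous_addl_comp.
have c2 : continuous (fun x => p x * f' (s + p x)).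
  by apply: continuous_mulT => //; exact: continuous_addl_comp.
have cb2 : continuous (fun x => b * (p x * f' (s + p x))).
  by apply: continuous_mulT => //; exact: continuous_cstT.
rewrite /average /average_weighted -RintegralZl//; last exact: continuous_integrable01.
rewrite -RintegralD//; [|exact: continuous_integrable01..].
have cF : continuous (fun x : R => x * f (s + p x)).
  by apply: continuous_mulT => // x; exact: cvg_id.
have dF (x : R) : 0 < x -> is_derive x 1 (fun x => x * f (s + p x))
    (f (s + p x) + b * (p x * f' (s + p x))).
  move=> x0.
  have dp : is_derive x 1 p (b * x `^ (b - 1)).
    apply: is_derive_eq_near (@is_derive1_powR R b x x0).
    near=> y; rewrite /p ger0_norm//; apply: ltW; near: y; exact: lt_nbhsr.
  have l0 : 0 < s + p x by rewrite ltr_wpDl// powR_gt0// normr_gt0 gt_eqF.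
  have d1 := is_derive_addR (is_derive_cstR s x) dp.
  have dfl : is_derive (s + p x) 1 f (f' (s + p x)) by exact: df.
  have d2 := @is_derive_compR R f (fun x => s + p x) x _ _ dfl d1.
  have d3 : is_derive x 1 (fun x : R => x) 1 by exact: is_derive_id.
  apply: (is_derive_eq (is_derive_mulR d3 d2)).
  rewrite mul1r add0r; congr (_ + _).
  have -> : x `^ (b - 1) = p x / x.
    by rewrite powRB ?(gt_eqF x0) ?implybT// powRr1 ?ltW// /p gtr0_norm.
  by field; rewrite gt_eqF.
rewrite /Rintegral (@continuous_FTC2 R _ (fun x => x * f (s + p x))) ?ltr01//.
- by rewrite -EFinB /= mul0r subr0 mul1r p1E.
- by apply: continuous_subspaceT; exact: continuous_addT.
- split.
  + by move=> x /[!in_itv]/= /andP[x0 _]; have [] := dF x x0.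
  + by apply: cvg_at_right_filter; exact: cF.
  + by apply: cvg_at_left_filter; exact: cF.
- by move=> x /[!in_itv]/= /andP[x0 _]; rewrite derive1E; have [_ ->] := dF x x0.
Unshelve. all: by end_near. Qed.

(** Integration by parts with [f l = l] and [s = 0] gives [(1 + b) I = 1]; the second moment below
    comes from [l^2] in the same way. *)
Lemma integral_norm_powR : \int[mu]_(x in `[0, 1]) p x = a / (a + 1).
Proof.
have c1 : continuous (fun _ : R => 1 : R) by exact: continuous_cstT.
have cid : continuous (fun x : R => x) by move=> x; exact: cvg_id.
have := @average_by_parts (fun x => x) (fun=> 1) 0 cid c1
  (fun (l : R) _ => is_derive_id l 1) (lexx _).
rewrite /average /average_weighted.
under eq_Rintegral do rewrite add0r.
under [in X in _ + _ * X]eq_Rintegral do rewrite mulr1.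
rewrite add0r => E.
have aN : a != 0 by rewrite gt_eqF.
have a1N : a + 1 != 0 by rewrite gt_eqF// addr_gt0.
set I := Rintegral _ _ _ in E *.
have -> : I = (I + b * I) * (a / (a + 1)) by rewrite /b; field; rewrite aN a1N.
by rewrite E mul1r.
Qed.

Lemma integral_norm_powR_sqr : \int[mu]_(x in `[0, 1]) (p x * p x) = a / (a + 2).
Proof.
have cid : continuous (fun x : R => x) by move=> x; exact: cvg_id.
have c1 : continuous (fun x : R => x * x) by exact: continuous_mulT.
have c2 : continuous (fun x : R => x + x) by exact: continuous_addT.
have d1 (l : R) : 0 < l -> is_derive l 1 (fun x : R => x * x) (l + l).
  move=> _; have dl : is_derive l 1 (fun x : R => x) 1 by exact: is_derive_id.
  by apply: (is_derive_eq (is_derive_mulR dl dl)); rewrite mul1r mulr1.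
have := @average_by_parts _ _ 0 c1 c2 d1 (lexx _).
rewrite /average /average_weighted.
under eq_Rintegral do rewrite add0r.
under [in X in _ + _ * X]eq_Rintegral do rewrite add0r mulrDr.
have ci : mu.-integrable `[0, 1] (EFin \o (fun x => p x * p x)).
  by apply: continuous_integrable01; exact: continuous_mulT.
rewrite RintegralD// add0r mul1r => E.
have aN : a != 0 by rewrite gt_eqF.
have a2N : a + 2 != 0 by rewrite gt_eqF// addr_gt0.
set I := Rintegral _ _ _ in E *.
have -> : I = (I + b * (I + I)) * (a / (a + 2)) by rewrite /b; field; rewrite aN a2N.
by rewrite E mul1r.
Qed.

Variables (tau r : R).
Hypotheses (t0 : 0 <= tau) (r0 : 0 <= r).
Local Notation kden := (kernel_den tau).
Local Notation kap := (kernel_arg tau).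
Local Notation w := (kernel_weight a tau r).
Let cD : continuous kden. Proof. exact: continuous_kden. Qed.
Let cK : continuous kap. Proof. exact: continuous_kap. Qed.
Let cw : continuous w. Proof. exact: continuous_kwt. Qed.
Let cN : continuous (fun x : R => `|x|). Proof. exact: continuous_norm. Qed.
Let cKw : continuous (fun x => kap x * w x). Proof. exact: continuous_mulT. Qed.
Let cNw : continuous (fun x => `|x| * w x). Proof. exact: continuous_mulT. Qed.
Let cDw : continuous (fun x => kden x * w x). Proof. exact: continuous_mulT. Qed.
Let w0 l : 0 <= w l. Proof. exact: kwt_ge0. Qed.
Let k0 l : 0 <= kap l. Proof. exact: kap_ge0. Qed.
Let D0 l : 0 < kden l. Proof. exact: kernel_den_gt0. Qed.

(* The weight [kap * w] is [l] times a nonincreasing function of [l], so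
   replacing the latter by its value at the sign change of
   [(a + 1) - (a + 2) p x] can only decrease the integral. *)
Lemma average_weighted_kap (s : R) : 0 <= s ->
  (a + 2) * average_weighted p (fun l => kap l * w l) s <=
  (a + 1) * average p (fun l => kap l * w l) s.
Proof.
move=> s0.
have cs : continuous (fun x => kap (s + p x) * w (s + p x)).
  exact: (continuous_addl_comp (f := fun l => kap l * w l)).
have cps : continuous (fun x => p x * (kap (s + p x) * w (s + p x))).
  exact: continuous_mulT.
rewrite -subr_ge0 /average /average_weighted.
rewrite -!RintegralZl//; [|exact: continuous_integrable01..].
have cz (c : R) (g : R -> R) : continuous g -> continuous (fun x => c * g x).
  by move=> cg; apply: continuous_mulT => //; exact: continuous_cstT.
rewrite -RintegralB//; [|by apply: continuous_integrable01; exact: cz..].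
have a1 : 0 < a + 1 by rewrite addr_gt0.
have a2 : 0 < a + 2 by rewrite addr_gt0.
pose l0 := (a + 1) / (a + 2).
pose c := w (s + l0) / kden (s + l0).
have l00 : 0 <= l0 by rewrite divr_ge0// ltW.
have c0 : 0 <= c by rewrite divr_ge0// ltW.
(* With the nonincreasing factor frozen at [c], the first two moments of [p] make this integral
   equal to [c * s / (a + 1)]. It vanishes at [s = 0], which is what fixes the ratio of [a + 1] to
   [a + 2]. *)
have Ic : 0 <= \int[mu]_(x in `[0, 1])
    (c * ((a + 1) * s + ((a + 1) - (a + 2) * s) * p x - (a + 2) * (p x * p x))).
  have cpp : continuous (fun x => p x * p x) by exact: continuous_mulT.
  have c1 : continuous (fun x => ((a + 1) - (a + 2) * s) * p x) by exact: cz.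
  have c2 : continuous (fun x => (a + 2) * (p x * p x)) by exact: cz.
  have c3 : continuous (fun _ : R => (a + 1) * s) by exact: continuous_cstT.
  have c4 : continuous (fun x => (a + 1) * s + ((a + 1) - (a + 2) * s) * p x).
    exact: continuous_addT.
  rewrite RintegralZl//; last first.
    apply: continuous_integrable01; apply: continuous_addT => //.
    exact: continuous_oppT.
  rewrite mulr_ge0// RintegralB//; [|exact: continuous_integrable01..].
  rewrite RintegralD//; [|exact: continuous_integrable01..].
  rewrite [X in _ + X - _]RintegralZl//; last exact: continuous_integrable01.
  rewrite [X in _ - X]RintegralZl//; last exact: continuous_integrable01.
  rewrite integral_norm_powR integral_norm_powR_sqr Rintegral_cst//= lebesgue_measure_itv/= lte01/=.
  rewrite subr0 mulr1.
  set X := (X in 0 <= X); have -> : X = s / (a + 1).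
    by rewrite /X; field; rewrite !gt_eqF.
  by rewrite divr_ge0// ltW.
apply: le_trans Ic _; apply: le_Rintegral => //.
- apply: continuous_integrable01; apply/cz.
  apply: continuous_addT; last by apply: continuous_oppT; apply/cz; exact: continuous_mulT.
  by apply: continuous_addT; [exact: continuous_cstT|exact: cz].
- apply: continuous_integrable01; apply: continuous_addT; first exact: cz.
  by apply: continuous_oppT; exact: cz.
move=> x /=; rewrite in_itv/= => x01; have /andP[px0 px1] := p01 x01.
have l0' : 0 <= s + p x by rewrite addr_ge0.
pose Dl := w (s + p x) / kden (s + p x).
have -> : kap (s + p x) * w (s + p x) = (s + p x) * Dl.
  by rewrite /kernel_arg /Dl ger0_norm// mulrAC -mulrA.
have -> : (a + 1) * ((s + p x) * Dl) - (a + 2) * (p x * ((s + p x) * Dl)) =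
   Dl * ((a + 1) - (a + 2) * p x) * (s + p x) by ring.
have -> : c * ((a + 1) * s + ((a + 1) - (a + 2) * s) * p x - (a + 2) * (p x * p x)) =
   c * ((a + 1) - (a + 2) * p x) * (s + p x) by ring.
rewrite ler_wpM2r//.
have [pl|/ltW lp] := leP (p x) l0.
  rewrite ler_wpM2r ?ler_kwt_kden// ?lerD2l//.
  by rewrite subr_ge0 -ler_pdivlMl// mulrC.
rewrite ler_wnM2r ?ler_kwt_kden// ?lerD2l//; last by rewrite addr_ge0.
by rewrite subr_le0 -ler_pdivrMl// mulrC.
Qed.

Section with_rho.
Variables (rho : nat -> probability T R) (n : nat).
Hypothesis rho0 : forall f : T -> \bar R,
  measurable_fun [set: T] f -> (forall x, 0 <= f x)%E ->
  (\int[rho 0%N]_s f s = f 0%R)%E.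
Hypothesis rhoS : forall n (f : T -> \bar R),
  measurable_fun [set: T] f -> (forall x, 0 <= f x)%E ->
  (\int[rho n.+1]_s f s = \int[rho n]_s \int[mu]_(x in `[0%R, 1%R]) f (s + p x)%R)%E.

(** [L] averages over all [n + 1] copies; [B] holds one copy at its endpoint value [p 1 = 1] and
    averages over the other [n]. *)
Let L (f : R -> R) : R := \int[rho n.+1]_s f s.
Let B (f : R -> R) : R := \int[rho n]_s f (s + 1).
Let ri := rho_integrable cp p01 rho0 rhoS.

(** Parts in one copy give a weight [p x], which [Rintegral_rho_id] turns into the factor
    [l / (n + 1)]. The derivative is split as [p1 - p2] because that lemma is about nonnegative
    functions. *)
Lemma Rintegral_rho_by_parts (f p1 p2 : R -> R) : continuous f -> continuous p1 -> continuous p2 ->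
  (forall l, 0 <= p1 l) -> (forall l, 0 <= p2 l) ->
  (forall l : R, 0 < l -> is_derive l 1 f (p1 l - p2 l)) ->
  n.+1%:R * L f + b * L (fun l => l * p1 l) = n.+1%:R * B f + b * L (fun l => l * p2 l).
Proof.
move=> cf c1 c2 p10 p20 df.
have E s : 0 <= s <= n%:R -> average p f s + b * average_weighted p p1 s =
    f (s + 1) + b * average_weighted p p2 s.
  move=> /andP[s0 _].
  have c12 : continuous (fun l => p1 l - p2 l).
    by apply: continuous_addT => //; exact: continuous_oppT.
  rewrite -(average_by_parts cf c12 df s0) -addrA -mulrDr; congr (_ + _ * _).
  have i1 : mu.-integrable `[0, 1] (EFin \o (fun x => p x * p1 (s + p x))).
    by apply: continuous_integrable01; apply: continuous_mulT => //; exact: continuous_addl_comp.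
  have i2 : mu.-integrable `[0, 1] (EFin \o (fun x => p x * p2 (s + p x))).
    by apply: continuous_integrable01; apply: continuous_mulT => //; exact: continuous_addl_comp.
  rewrite /average_weighted.
  under [X in _ = X + _]eq_Rintegral do rewrite mulrBr.
  by rewrite RintegralB// subrK.
have ca : continuous (average p f) by exact: continuous_average.
have cw1 : continuous (average_weighted p p1) by exact: continuous_average_weighted.
have cw2 : continuous (average_weighted p p2) by exact: continuous_average_weighted.
have cf1 : continuous (fun s : R => f (s + 1)) by exact: (continuous_translate (f := f)).
have cz (c : R) (g : R -> R) : continuous g -> continuous (fun x => c * g x).
  by move=> cg; apply: continuous_mulT => //; exact: continuous_cstT.
have := @eq_Rintegral_rho _ _ _ cp p01 rho0 rhoS n
  (fun s => average p f s + b * average_weighted p p1 s)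
  (fun s => f (s + 1) + b * average_weighted p p2 s)
  (continuous_addT ca (cz b _ cw1)) (continuous_addT cf1 (cz b _ cw2)) E.
rewrite !RintegralD//; [|first [exact/ri|exact/ri/cz]..].
rewrite !RintegralZl//; [|exact/ri..].
rewrite -(Rintegral_rhoS cp p01 rho0 rhoS n cf) => E'.
rewrite /L (Rintegral_rho_id cp p01 rho0 rhoS n c1 p10).
rewrite (Rintegral_rho_id cp p01 rho0 rhoS n c2 p20).
by rewrite !(mulrCA b) -!mulrDr E'.
Qed.

Let LD (f g : R -> R) : continuous f -> continuous g ->
  L (fun x => f x + g x) = L f + L g.
Proof. by move=> cf cg; rewrite /L RintegralD//; exact/ri. Qed.

Let LZ (c : R) (f : R -> R) : continuous f -> L (fun x => c * f x) = c * L f.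
Proof. by move=> cf; rewrite /L RintegralZl//; exact/ri. Qed.

Let eqL (f g : R -> R) : continuous f -> continuous g ->
  (forall l : R, 0 <= l -> f l = g l) -> L f = L g.
Proof.
move=> cf cg fg; apply: (eq_Rintegral_rho cp p01 rho0 rhoS cf cg).
by move=> x /andP[x0 _]; exact: fg.
Qed.

Let M0 := L w.
Let M1 := L (fun l => kap l * w l).
Let M2 := L (fun l => kap l * (kap l * w l)).
Let Q := L (fun l => `|l| * w l).
Let P := L (fun l => `|l| * (kap l * w l)).
Let B2 := B (fun l => `|l| * w l).
Let B1 := B (fun l => kden l * w l).

Let cKKw : continuous (fun l => kap l * (kap l * w l)).
Proof. exact: continuous_mulT. Qed.
Let cNKw : continuous (fun l => `|l| * (kap l * w l)).
Proof. exact: continuous_mulT. Qed.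
Let cid : continuous (fun x : R => x). Proof. by move=> x; exact: cvg_id. Qed.
Let cz (c : R) (g : R -> R) : continuous g -> continuous (fun x => c * g x).
Proof. by move=> cg; apply: continuous_mulT => //; exact: continuous_cstT. Qed.

Lemma norm_moment_eq : Q = M1 + tau * P.
Proof.
rewrite /Q /M1 /P -LZ// -LD//; last exact/cz.
apply: eqL => //.
  by apply: continuous_addT => //; exact/cz.
by move=> l _; rewrite {1}(norm_kap t0 l); ring.
Qed.

Lemma second_moment_eq : r * M2 = (a + 1) * M1 + a * n%:R * Q - a * n.+1%:R * B2.
Proof.
have cv : continuous (fun l => w l * kap l * (r / kden l + (a + 1) * tau)).
  apply: continuous_mulT; first exact: continuous_mulT.
  apply: continuous_addT; last exact: continuous_cstT.
  by apply/cz/continuous_invT => // l; exact: kernel_den_neq0.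
have v0 l : 0 <= w l * kap l * (r / kden l + (a + 1) * tau).
  apply: mulr_ge0; first exact: mulr_ge0.
  apply: addr_ge0; first by rewrite divr_ge0// ltW.
  by rewrite mulr_ge0// addr_ge0// ltW.
have := Rintegral_rho_by_parts cNw cw cv w0 v0 (fun l l0 => is_derive_norm_kwt a r t0 l0).
rewrite -/Q -/B2.
have -> : L (fun l => l * w l) = Q.
  by apply: eqL => // [|l l0]; [exact: continuous_mulT|rewrite ger0_norm].
have -> : L (fun l => l * (w l * kap l * (r / kden l + (a + 1) * tau))) =
    r * M2 + (a + 1) * tau * P.
  rewrite /M2 /P -!LZ// -LD; [|exact/cz..].
  apply: eqL.
  - exact: continuous_mulT.
  - by apply: continuous_addT; exact/cz.
  - move=> l l0; have Dn := kernel_den_neq0 t0 l.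
    have := kap_kden t0 l; rewrite ger0_norm// => lE.
    by move: (kap l) (kden l) (w l) lE Dn => k D W <- Dn; field.
have aN : a != 0 by rewrite gt_eqF.
move=> /(congr1 (fun x => a * x)).
rewrite !mulrDr ![a * (b * _)]mulrA mulfV// !mul1r => E.
have tP : tau * P = Q - M1 by rewrite norm_moment_eq addrAC subrr add0r.
have -> : r * M2 = a * (n.+1%:R * Q) + Q - a * (n.+1%:R * B2) - (a + 1) * (tau * P).
  by rewrite E; ring.
by rewrite tP -natr1; ring.
Qed.

Lemma first_moment_eq : r * M1 = a * n.+1%:R * M0 + a * n%:R * tau * Q - a * n.+1%:R * B1.
Proof.
have cv : continuous (fun l => w l * (r / kden l + a * tau)).
  apply: continuous_mulT => //.
  apply: continuous_addT; last exact: continuous_cstT.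
  by apply/cz/continuous_invT => // l; exact: kernel_den_neq0.
have v0 l : 0 <= w l * (r / kden l + a * tau).
  apply: mulr_ge0 => //; apply: addr_ge0; first by rewrite divr_ge0// ltW.
  by rewrite mulr_ge0// ltW.
have := Rintegral_rho_by_parts cDw (@continuous_cstT R 0) cv (fun _ => lexx _) v0
  (fun l l0 => is_derive_kden_kwt a r t0 l0).
rewrite -/B1.
have -> : L (fun l : R => l * 0) = 0.
  have -> : (fun l : R => l * 0) = (fun l => 0 * w l).
    by apply/funext => l; rewrite mulr0 mul0r.
  by rewrite LZ// mul0r.
have -> : L (fun l => kden l * w l) = M0 + tau * Q.
  rewrite /Q -LZ// -LD//; last exact/cz.
  apply: eqL => //; first by apply: continuous_addT => //; exact/cz.
  by move=> l _; rewrite /kernel_den; ring.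
have -> : L (fun l => l * (w l * (r / kden l + a * tau))) = r * M1 + a * tau * Q.
  rewrite /M1 /Q -!LZ// -LD; [|exact/cz..].
  apply: eqL.
  - exact: continuous_mulT.
  - by apply: continuous_addT; exact/cz.
  - move=> l l0; have Dn := kernel_den_neq0 t0 l.
    by rewrite /kernel_arg ger0_norm//; field.
have aN : a != 0 by rewrite gt_eqF.
move=> /(congr1 (fun x => a * x)).
rewrite !mulrDr ![a * (b * _)]mulrA mulfV// !mul1r => E.
have -> : r * M1 = a * (n.+1%:R * M0) + a * (n.+1%:R * (tau * Q)) -
    a * (n.+1%:R * B1) - a * tau * Q.
  by move: E; rewrite addr0 => ->; ring.
by rewrite -natr1; ring.
Qed.

(** By symmetry [P] is [n + 1] times a moment weighted by one copy, and [average_weighted_kap]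
    bounds that copy for every value of the others. *)
Lemma cross_moment_le : (a + 2) * P <= (a + 1) * n.+1%:R * M1.
Proof.
have kw0 l : 0 <= kap l * w l by rewrite mulr_ge0.
have -> : P = L (fun l => l * (kap l * w l)).
  by apply: eqL => // [|l l0]; [exact: continuous_mulT|rewrite ger0_norm].
rewrite /L (Rintegral_rho_id cp p01 rho0 rhoS n cKw kw0).
rewrite /M1 /L (Rintegral_rhoS cp p01 rho0 rhoS n cKw).
rewrite mulrCA -mulrA [leRHS]mulrCA ler_wpM2l//.
have ca : continuous (average p (fun l => kap l * w l)).
  exact: continuous_average.
have cwa : continuous (average_weighted p (fun l => kap l * w l)).
  exact: continuous_average_weighted.
rewrite -!RintegralZl//; [|exact/ri..].
apply: (le_Rintegral_rho cp p01 rho0 rhoS); [exact/cz..|].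
by move=> s /andP[s0 _]; exact: average_weighted_kap.
Qed.

(* Chebyshev's inequality: both [kap (s + lam)] and
   [kden (s + 1) * w (s + 1) / w (s + lam)] are nondecreasing in [s]. *)
Lemma chebyshev_slice (lam : R) : 0 <= lam <= 1 ->
  (\int[rho n]_s (kap (s + lam) * w (s + lam))) * B1 <=
  (\int[rho n]_s w (s + lam)) * B2.
Proof.
move=> lam01; have /andP[lam0 lam1] := lam01.
set m1 := Rintegral _ _ _; set m0 := Rintegral _ _ _.
have c0 : continuous (fun s : R => w (s + lam)) by exact: (continuous_translate (f := w)).
have c1 : continuous (fun s : R => kap (s + lam) * w (s + lam)).
  exact: (continuous_translate (f := fun l => kap l * w l)).
have cb1 : continuous (fun s : R => kden (s + 1) * w (s + 1)).
  exact: (continuous_translate (f := fun l => kden l * w l)).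
have cb2 : continuous (fun s : R => `|s + 1| * w (s + 1)).
  exact: (continuous_translate (f := fun l => `|l| * w l)).
(* Integrating [X s s'] in both variables gives the right side minus the left side of the claim, so
   it suffices that the symmetrised [X s s' + X s' s] is nonnegative. *)
pose X s s' := w (s + lam) * (`|s' + 1| * w (s' + 1)) -
  kap (s + lam) * w (s + lam) * (kden (s' + 1) * w (s' + 1)).
have XE s s' : X s s' = w (s + lam) * (kden (s' + 1) * w (s' + 1)) *
   (kap (s' + 1) - kap (s + lam)).
  by rewrite /X -(kap_kden t0 (s' + 1)); ring.
have X0 s s' : 0 <= s -> s <= s' -> 0 <= X s s' + X s' s.
  move=> s0 ss'; have s'0 := le_trans s0 ss'; rewrite !XE.
  have H := kwt_ratio a0 t0 r0 s0 ss' lam01.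
  set al := w (s + lam) * _ in H *; set be := w (s' + lam) * _ in H *.
  have be0 : 0 <= be by rewrite mulr_ge0// mulr_ge0// ltW.
  have K1 : kap (s' + lam) <= kap (s' + 1) by rewrite ler_kap ?addr_ge0// lerD2l.
  have K2 : kap (s + lam) <= kap (s + 1) by rewrite ler_kap ?addr_ge0// lerD2l.
  have K3 : kap (s + lam) <= kap (s' + lam) by rewrite ler_kap ?addr_ge0// lerD2r.
  (* Here [al >= be] by [kwt_ratio], and each difference of [kap] on the right is nonnegative
     because [s <= s'] and [lam <= 1]. *)
  have -> : al * (kap (s' + 1) - kap (s + lam)) + be * (kap (s + 1) - kap (s' + lam)) =
    (al - be) * (kap (s' + lam) - kap (s + lam)) + al * (kap (s' + 1) - kap (s' + lam)) +
    be * (kap (s + 1) - kap (s + lam)) by ring.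
  by rewrite !addr_ge0// mulr_ge0// ?subr_ge0// (le_trans be0).
have X0' s s' : 0 <= s -> 0 <= s' -> 0 <= X s s' + X s' s.
  by move=> s0 s'0; have [/X0|/ltW/X0] := leP s s'; [exact|rewrite addrC; exact].
have Y0 s : 0 <= s -> 0 <= w (s + lam) * B2 - kap (s + lam) * w (s + lam) * B1 +
    (`|s + 1| * w (s + 1) * m0 - kden (s + 1) * w (s + 1) * m1).
  move=> s0.
  rewrite /B1 /B2 /B /m0 /m1 -!RintegralZl//; [|exact/ri..].
  rewrite -!RintegralB//; [|exact/ri/cz..].
  have cB (f g : R -> R) : continuous f -> continuous g -> continuous (fun x => f x - g x).
    by move=> cf cg; apply: continuous_addT => //; exact: continuous_oppT.
  rewrite -RintegralD//; [|by apply/ri; apply: cB; exact/cz..].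
  apply: (Rintegral_rho_ge0 cp p01 rho0 rhoS).
    by apply: continuous_addT; apply: cB; exact/cz.
  move=> s' /andP[s'0 _]; have := X0' _ _ s0 s'0.
  by rewrite /X [w (s' + lam) * _]mulrC [kap (s' + lam) * _ * _]mulrC.
have czr (f : R -> R) (c : R) : continuous f -> continuous (fun x => f x * c).
  by move=> cf; apply: continuous_mulT => //; exact: continuous_cstT.
have cB (f g : R -> R) : continuous f -> continuous g -> continuous (fun x => f x - g x).
  by move=> cf cg; apply: continuous_addT => //; exact: continuous_oppT.
have : 0 <= \int[rho n]_s (w (s + lam) * B2 - kap (s + lam) * w (s + lam) * B1 +
    (`|s + 1| * w (s + 1) * m0 - kden (s + 1) * w (s + 1) * m1)).
  apply: (Rintegral_rho_ge0 cp p01 rho0 rhoS).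
    by apply: continuous_addT; apply: cB; exact/czr.
  by move=> s /andP[s0 _]; exact: Y0.
rewrite RintegralD//; [|by apply/ri; apply: cB; exact/czr..].
rewrite !RintegralB//; [|exact/ri/czr..].
rewrite !RintegralZr//; [|exact/ri..].
rewrite -/m0 -/m1 -/B2 -/B1 /B2 /B1 /B.
lra.
Qed.

(** Condition on one copy having the value [lam = p x], apply [chebyshev_slice], and integrate over
    [x]. *)
Lemma chebyshev_boundary : M1 * B1 <= M0 * B2.
Proof.
have kw0 l : 0 <= kap l * w l by rewrite mulr_ge0.
rewrite /M1 /M0 /L (Rintegral_rhoS cp p01 rho0 rhoS n cKw).
rewrite (Rintegral_rhoS cp p01 rho0 rhoS n cw).
rewrite (Rintegral_rho_average cp p01 rho0 rhoS n cKw kw0).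
rewrite (Rintegral_rho_average cp p01 rho0 rhoS n cw w0).
have i1 := integrable01_rho_shift cp p01 rho0 rhoS n cKw kw0.
have i2 := integrable01_rho_shift cp p01 rho0 rhoS n cw w0.
rewrite -!RintegralZr//.
have iz (f : R -> R) (c : R) : mu.-integrable `[0, 1] (EFin \o f) ->
   mu.-integrable `[0, 1] (EFin \o (fun x => f x * c)).
  have mI : measurable (`[0, 1] : set T) by [].
  by move=> fi; exact: (integrableZr mI c fi).
apply: le_Rintegral => //; [exact: iz|exact: iz|].
by move=> x /=; rewrite in_itv/= => /p01; exact: chebyshev_slice.
Qed.

Lemma moment_inequality (c : R) : 0 <= c < 1 ->
  tau * (n.+1%:R * n%:R * (a + 1)) <= (a + 2) * (1 - c) ->
  M0 * (r * M2) <= (a + 1) * M0 * M1 + (1 - c / n.+1%:R) * M1 * (r * M1).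
Proof.
move=> /andP[c0 c1] htau.
have N0 : 0 < n.+1%:R :> R by rewrite ltr0n.
have n0 : 0 <= n%:R :> R by [].
have a1 : 0 < a + 1 by rewrite addr_gt0.
have a2 : 0 < a + 2 by rewrite addr_gt0.
have L0 (f : R -> R) : (forall x, 0 <= f x) -> 0 <= L f.
  by move=> f0; apply: Rintegral_ge0 => x _; exact: f0.
have M00 : 0 <= M0 by exact: L0.
have M10 : 0 <= M1 by apply: L0 => x; rewrite mulr_ge0.
have Q0 : 0 <= Q by apply: L0 => x; rewrite mulr_ge0.
have P0 : 0 <= P by apply: L0 => x; rewrite mulr_ge0// mulr_ge0.
have B10 : 0 <= B1 by apply: Rintegral_ge0 => x _; rewrite mulr_ge0// ltW.
have al := chebyshev_boundary.
have q01 : 0 <= 1 - c / n.+1%:R.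
  rewrite subr_ge0 ler_pdivrMr// mul1r (le_trans (ltW c1))//.
  by rewrite ler1n.
(* The only place where the bound on [tau] is used; it is the product of that bound with
   [cross_moment_le]. *)
have be : n%:R * tau * P <= (1 - c) * M1.
  rewrite -(ler_pM2l a2) -(ler_pM2l a1).
  apply: (@le_trans _ _ ((a + 1) * n%:R * tau * ((a + 1) * n.+1%:R * M1))).
    have -> : (a + 1) * ((a + 2) * (n%:R * tau * P)) =
      (a + 1) * n%:R * tau * ((a + 2) * P) by ring.
    by rewrite ler_wpM2l ?cross_moment_le// !mulr_ge0// ltW.
  have -> : (a + 1) * n%:R * tau * ((a + 1) * n.+1%:R * M1) =
    tau * (n.+1%:R * n%:R * (a + 1)) * ((a + 1) * M1) by ring.
  have -> : (a + 1) * ((a + 2) * ((1 - c) * M1)) =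
    (a + 2) * (1 - c) * ((a + 1) * M1) by ring.
  by rewrite ler_wpM2r// mulr_ge0// ltW.
have qN : (1 - c / n.+1%:R) * n.+1%:R = n.+1%:R - c.
  by field; rewrite gt_eqF.
rewrite second_moment_eq first_moment_eq.
set q := 1 - c / n.+1%:R in q01 qN *.
rewrite -subr_ge0.
(* After the two identities the slack has four terms. The last two come from the boundary, by
   Chebyshev and by [q <= 1]; the first is nonnegative by [be], through
   [q * n.+1%:R = n%:R + (1 - c)]. *)
have -> : (a + 1) * M0 * M1 + q * M1 *
    (a * n.+1%:R * M0 + a * n%:R * tau * Q - a * n.+1%:R * B1) -
    M0 * ((a + 1) * M1 + a * n%:R * Q - a * n.+1%:R * B2) =
  a * (M0 * ((q * n.+1%:R) * M1 - n%:R * Q)) + a * n%:R * tau * q * M1 * Q +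
  a * n.+1%:R * (M0 * B2 - M1 * B1) + a * n.+1%:R * (1 - q) * (M1 * B1) by ring.
rewrite qN norm_moment_eq.
have q1 : 0 <= 1 - q by rewrite /q opprB addrCA subrr addr0 divr_ge0.
have E : n.+1%:R - c = n%:R + (1 - c) by rewrite -natr1; ring.
have h : 0 <= (n.+1%:R - c) * M1 - n%:R * (M1 + tau * P).
  rewrite E; have -> : (n%:R + (1 - c)) * M1 - n%:R * (M1 + tau * P) =
    (1 - c) * M1 - n%:R * tau * P by ring.
  by rewrite subr_ge0.
have a0' := ltW a0.
rewrite -norm_moment_eq in h *.
rewrite !addr_ge0// ?mulr_ge0// ?subr_ge0//.
Qed.

End with_rho.
End moment_inequality.

(** * Directional derivatives and the Laplacian of a radial function *)

Section directional.
Variable R : realType.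

(** Allows differentiation under the integral sign by integrating a pointwise Taylor remainder. *)
Lemma is_derive_quadratic (f : R -> R) (x df C : R) :
  (forall h, `|h| <= 1 -> `|f (x + h) - f x - h * df| <= C * h ^+ 2) ->
  is_derive x 1 f df.
Proof.
move=> H.
have C0 : 0 <= C.
  by have := H 1 (eq_ind_r (fun z => z <= 1) (lexx _) (normr1 R)); rewrite expr1n mulr1; exact: le_trans.
have cv : h^-1 *: ((f \o shift x) (h *: (1 : R)) - f x) @[h --> 0^'] --> df.
  apply/cvgrPdist_le => e e0; near=> h.
  have h0 : h != 0 by near: h; exact: nbhs_dnbhs_neq.
  have h1 : `|h| <= 1 by apply: ltW; near: h; exact: dnbhs0_lt.
  have h2 : `|h| <= e / (C + 1).
    by apply: ltW; near: h; apply: dnbhs0_lt; rewrite divr_gt0// ltr_wpDl.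
  rewrite /= /GRing.scale /= mulr1 [h + x]addrC.
  have -> : df - h^-1 * (f (x + h) - f x) = - (h^-1 * (f (x + h) - f x - h * df)).
    by field.
  rewrite normrN normrM normfV ler_pdivrMl ?normr_gt0//.
  apply: le_trans (H h h1) _.
  rewrite -(real_normK (num_real h)) expr2 mulrCA ler_wpM2l//.
  apply: (@le_trans _ _ ((C + 1) * `|h|)); first by rewrite ler_wpM2r// lerDl.
  by rewrite mulrC -ler_pdivlMr// ltr_wpDl.
split; first exact: cvgP cv.
exact: cvg_lim cv.
Unshelve. all: by end_near. Qed.

Lemma is_derive_line (V : normedModType R) (F : V -> R) (u v : V) (df : R) :
  is_derive (0 : R) 1 (fun h : R => F (h *: v + u)) df -> is_derive u v F df.
Proof.
have E : (fun h : R => h^-1 *: (((fun h : R => F (h *: v + u)) \o shift 0) (h *: (1 : R)) -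
     F (0 *: v + u))) = (fun h => h^-1 *: ((F \o shift u) (h *: v) - F u)).
  by apply/funext => h /=; rewrite addr0 scale0r add0r /GRing.scale /= mulr1.
move=> [d1 d2]; split.
  by move: d1; rewrite /derivable E.
by move: d2; rewrite /derive E.
Qed.

Lemma enorm_sqr_line d (u : 'rV[R]_d) (i : 'I_d) (h : R) :
  \sum_(j < d) (h *: @ebasis R d i + u) ord0 j ^+ 2 =
  \sum_(j < d) u ord0 j ^+ 2 + 2 * u ord0 i * h + h ^+ 2.
Proof.
rewrite (bigD1 i)//= [in RHS](bigD1 i)//= !mxE !eqxx/= mulr1.
rewrite (eq_bigr (fun j => u ord0 j ^+ 2)); first by ring.
by move=> j ji; rewrite !mxE eqxx/= (negbTE ji) mulr0 add0r.
Qed.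

Section radial_function.
Variables (d : nat) (f f1 f2 : R -> R).
Hypothesis df : forall q : R, is_derive q 1 f (f1 q).
Hypothesis df1 : forall q : R, is_derive q 1 f1 (f2 q).
Let nsq (u : 'rV[R]_d) := \sum_(j < d) u ord0 j ^+ 2.
Let F (u : 'rV[R]_d) := f (nsq u).

Let dq (u : 'rV[R]_d) (i : 'I_d) :
  is_derive (0 : R) 1 (fun h : R => nsq u + 2 * u ord0 i * h + h ^+ 2) (2 * u ord0 i).
Proof.
have d0 : is_derive (0 : R) 1 (fun x : R => x) 1 by exact: is_derive_id.
have d1 := is_derive_scaleR (2 * u ord0 i) d0.
have := is_derive_addR (is_derive_addR (is_derive_cstR (nsq u) 0) d1) (is_derive_mulR d0 d0).
by move=> d2; apply: (is_derive_eq d2); ring.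
Qed.

(** Functions of the squared norm stay smooth at [u = 0], since along a coordinate line it is the
    polynomial [|u|^2 + 2 u_i h + h^2]. *)
Lemma is_derive_radial (u : 'rV[R]_d) (i : 'I_d) :
  is_derive u (@ebasis R d i) F (2 * u ord0 i * f1 (nsq u)).
Proof.
apply: is_derive_line; rewrite /F /nsq.
under eq_fun => h do rewrite enorm_sqr_line.
apply: (is_derive_eq (is_derive_compR (df _) (dq u i))).
by rewrite mulr0 expr0n/= !addr0 mulrC.
Qed.

Lemma is_derive2_radial (u : 'rV[R]_d) (i : 'I_d) :
  is_derive u (@ebasis R d i) (fun x => derive F x (@ebasis R d i))
    (2 * f1 (nsq u) + 4 * u ord0 i ^+ 2 * f2 (nsq u)).
Proof.
have -> : (fun x => derive F x (@ebasis R d i)) = fun x => 2 * x ord0 i * f1 (nsq x).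
  by apply/funext => x; have [_ ->] := is_derive_radial x i.
apply: is_derive_line.
have -> : (fun h : R => 2 * (h *: @ebasis R d i + u) ord0 i *
    f1 (nsq (h *: @ebasis R d i + u))) =
  (fun h : R => 2 * (h + u ord0 i) * f1 (nsq u + 2 * u ord0 i * h + h ^+ 2)).
  apply/funext => h; rewrite /nsq enorm_sqr_line !mxE !eqxx/= mulr1.
  by [].
have d0 : is_derive (0 : R) 1 (fun x : R => x) 1 by exact: is_derive_id.
have d1 := is_derive_scaleR 2 (is_derive_addR d0 (is_derive_cstR (u ord0 i) 0)).
have d2 := is_derive_compR (df1 _) (dq u i).
apply: (is_derive_eq (is_derive_mulR d1 d2)).
by rewrite mulr0 expr0n/= !addr0 add0r; ring.
Qed.

Lemma laplacian_radial (u : 'rV[R]_d) :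
  laplacian F u = 2 * d%:R * f1 (nsq u) + 4 * nsq u * f2 (nsq u).
Proof.
rewrite /laplacian (eq_bigr (fun i => 2 * f1 (nsq u) + 4 * u ord0 i ^+ 2 * f2 (nsq u))).
  rewrite big_split /= sumr_const card_ord -mulr_suml -mulr_sumr -/(nsq u).
  by rewrite -[(2 * _) *+ d]mulr_natr; ring.
by move=> i _; have [_ ->] := is_derive2_radial u i.
Qed.

End radial_function.

(** Both bounds come from [expR z >= 1 + z], at [z = y] and at [z = - y]. *)
Lemma expR_taylor1 (y : R) : `|expR y - 1 - y| <= y ^+ 2 * expR `|y|.
Proof.
have e1 := expR_ge1Dx y.
have e2 : expR y - 1 <= y * expR y.
  have := expR_ge1Dx (- y); rewrite expRN => h.
  have := ler_wpM2r (expR_ge0 y) h.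
  rewrite mulVf ?gt_eqF ?expR_gt0//; lra.
rewrite ger0_norm; last by lra.
have [y0|/ltW y0] := leP 0 y.
  rewrite ger0_norm//; have := ler_wpM2l y0 e2; rewrite expr2 -mulrA; lra.
have le1 : 1 <= expR `|y| by rewrite -expR0 ler_expR.
apply: (@le_trans _ _ (y ^+ 2)); last by rewrite ler_peMr// sqr_ge0.
have := ler_wnM2l y0 e1; rewrite expr2; lra.
Qed.

End directional.

(** * Differentiation of the moments in [r] *)

Section moments.
Variables (R : realType) (a tau : R).
Hypotheses (a0 : 0 < a) (t0 : 0 <= tau).
Local Notation mu := (@lebesgue_measure R).
Local Notation T := (measurableTypeR R).
Variables (p : R -> R) (rho : nat -> probability T R) (n : nat).
Hypothesis cp : continuous p.
Hypothesis p01 : forall x : R, 0 <= x <= 1 -> 0 <= p x <= 1.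
Hypothesis rho0 : forall f : T -> \bar R,
  measurable_fun [set: T] f -> (forall x, 0 <= f x)%E ->
  (\int[rho 0%N]_s f s = f 0%R)%E.
Hypothesis rhoS : forall n (f : T -> \bar R),
  measurable_fun [set: T] f -> (forall x, 0 <= f x)%E ->
  (\int[rho n.+1]_s f s = \int[rho n]_s \int[mu]_(x in `[0%R, 1%R]) f (s + p x)%R)%E.
Let ri := rho_integrable cp p01 rho0 rhoS.

(** Taking [W = 1] and then [W = kernel_arg tau] gives the first two derivatives of g. All real [r]
    are covered, as the Laplacian of a radial function asks for derivatives at every real
    argument. *)
Lemma is_derive_moment (W : R -> R) (r : R) : continuous W ->
  is_derive r 1 (fun r => \int[rho n]_l (W l * kernel_weight a tau r l))
    (- \int[rho n]_l (kernel_arg tau l * (W l * kernel_weight a tau r l))).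
Proof.
move=> cW.
have cK := continuous_kap t0.
have cWk (s : R) : continuous (fun l => W l * kernel_weight a tau s l).
  by apply: continuous_mulT => //; exact: continuous_kwt.
have cKWk : continuous (fun l => kernel_arg tau l * (W l * kernel_weight a tau r l)).
  exact: continuous_mulT.
have cz (c : R) (g : R -> R) : continuous g -> continuous (fun x => c * g x).
  by move=> cg; apply: continuous_mulT => //; exact: continuous_cstT.
(* Moving [r] by [h] multiplies the weight by [expR (- (h * kernel_arg tau l))], so [G l * h^2]
   bounds the Taylor remainder for [|h| <= 1]. *)
pose G (l : R) := kernel_arg tau l ^+ 2 * expR (kernel_arg tau l) * `|W l * kernel_weight a tau r l|.
have cG : continuous G.
  apply: continuous_mulT; last first.
    by apply: (continuousT_comp (cWk r)) => x; exact: norm_continuous.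
  apply: continuous_mulT; last exact: continuous_expRT.
  by have := continuous_mulT cK cK.
apply: (@is_derive_quadratic _ _ _ _ (\int[rho n]_l G l)) => h h1.
have cB (f g : R -> R) : continuous f -> continuous g -> continuous (fun x => f x - g x).
  by move=> cf cg; apply: continuous_addT => //; exact: continuous_oppT.
have cD : continuous (fun l => W l * kernel_weight a tau (r + h) l - W l * kernel_weight a tau r l).
  exact: cB.
rewrite mulrN opprK -RintegralZl//; last exact/ri.
rewrite -RintegralB//; [|exact/ri..].
rewrite -RintegralD//; [|exact/ri|exact/ri/cz].
have cX : continuous (fun l => W l * kernel_weight a tau (r + h) l - W l * kernel_weight a tau r l +
    h * (kernel_arg tau l * (W l * kernel_weight a tau r l))).
  by apply: continuous_addT => //; exact/cz.
apply: le_trans (le_normr_Rintegral _ (ri n cX)) _ => //.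
rewrite -RintegralZr//; last exact/ri.
apply: le_Rintegral => //.
- by apply/ri; apply: (continuousT_comp cX) => x; exact: norm_continuous.
- by apply/ri; apply: continuous_mulT => //; exact: continuous_cstT.
move=> l _.
have E : kernel_weight a tau (r + h) l = kernel_weight a tau r l * expR (- (h * kernel_arg tau l)).
  rewrite /kernel_weight mulrAC -expRD; congr (expR _ * _); ring.
have -> : W l * kernel_weight a tau (r + h) l - W l * kernel_weight a tau r l +
    h * (kernel_arg tau l * (W l * kernel_weight a tau r l)) =
    (W l * kernel_weight a tau r l) * (expR (- (h * kernel_arg tau l)) - 1 - (- (h * kernel_arg tau l))).
  by rewrite E; ring.
rewrite normrM /G [leRHS]mulrAC [leRHS]mulrC ler_wpM2l//.
apply: le_trans (expR_taylor1 _) _.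
have -> : kernel_arg tau l ^+ 2 * expR (kernel_arg tau l) * h ^+ 2 =
  (- (h * kernel_arg tau l)) ^+ 2 * expR (kernel_arg tau l) by ring.
apply: ler_wpM2l; first exact: sqr_ge0.
rewrite ler_expR normrN normrM (ger0_norm (kap_ge0 t0 l)).
by rewrite ler_piMl// kap_ge0.
Qed.

Lemma moment_gt0 (r : R) : 0 < \int[rho n]_l kernel_weight a tau r l.
Proof.
have ck : continuous (kernel_weight a tau r) by exact: continuous_kwt.
have cs : {within `[0, n%:R], continuous (kernel_weight a tau r)} by exact: continuous_subspaceT.
have [c _ Hc] := EVT_min (ler0n R n) cs.
apply: (@lt_le_trans _ _ (\int[rho n]_l kernel_weight a tau r c)).
  by rewrite Rintegral_cst//= probability_setT/= mulr1 kwt_gt0.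
apply: (le_Rintegral_rho cp p01 rho0 rhoS) => //; first exact: continuous_cstT.
Qed.

End moments.

(** * The Gaussian expectation of the power of [mH] *)

Section gaussian_expectation.
Variables (R : realType) (d : nat) (v t C : R) (N : nat).
Hypotheses (d3 : (3 <= d)%N) (v0 : 0 < v) (C0 : 0 < C).
Local Notation mu := (@lebesgue_measure R).
Local Notation T := (measurableTypeR R).
Let a : R := (d%:R - 2) / 2.
Let b := a^-1.
Let a0 : 0 < a.
Proof. by rewrite divr_gt0// subr_gt0 (ltr_nat R 2 d). Qed.
Let b0 : 0 < b. Proof. by rewrite invr_gt0. Qed.
Let p (x : R) : R := `|x| `^ b.
Let tau := t ^+ 2 / v.
Hypothesis p01 : forall x : R, 0 <= x <= 1 -> 0 <= p x <= 1.
Hypothesis mHE : forall w : 'rV[R]_d, mH w v = C * \int[mu]_(x in `[0%R, 1%R])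
    expR (- (enorm w ^+ 2 / (2 * v) * `|x| `^ b)).
Variable rho : nat -> probability T R.
Hypothesis rho0 : forall f : T -> \bar R,
  measurable_fun [set: T] f -> (forall x, 0 <= f x)%E ->
  (\int[rho 0%N]_s f s = f 0%R)%E.
Hypothesis rhoS : forall n (f : T -> \bar R),
  measurable_fun [set: T] f -> (forall x, 0 <= f x)%E ->
  (\int[rho n.+1]_s f s = \int[rho n]_s \int[mu]_(x in `[0%R, 1%R]) f (s + p x)%R)%E.
Let cp : continuous p. Proof. exact: continuous_norm_powR. Qed.

(** The power of the mixture is an average of [expR (- (q * l))] over [rho N], with [q] quadratic in
    [z]. It factors over coordinates, and each Gaussian integral contributes [kernel_den tau l] to
    the power [-1/2]. *)
Lemma EZ_mH_pow (u : 'rV[R]_d) :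
  EZ (fun z => mH (t *: z + u) v ^+ N) =
  C ^+ N * \int[rho N]_l kernel_weight a tau (enorm u ^+ 2 / (2 * v)) l.
Proof.
have tau0 : 0 <= tau by rewrite divr_ge0 ?sqr_ge0// ltW.
have CN0 : 0 <= C ^+ N by rewrite exprn_ge0// ltW.
have vn0 : v != 0 by rewrite gt_eqF.
pose o : 'I_d := Ordinal (ltn_trans (isT : (0 < 2)%N) d3).
pose W (i : nat) : R := u ord0 (insubd o i).
pose h (i : nat) (l y : R) : R :=
  gauss1 1 (y - 0) * expR (- (`|l| / v * (t * y + W i) ^+ 2 / 2)).
pose H (i : nat) (l : R) : R :=
  (Num.sqrt (1 + 1 * (`|l| / v) * t ^+ 2))^-1 *
  expR (- (`|l| / v * (t * 0 + W i) ^+ 2 / (2 * (1 + 1 * (`|l| / v) * t ^+ 2)))).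
have cN : continuous (fun x : R => `|x|) by exact: continuous_norm.
have cNv : continuous (fun x : R => `|x| / v).
  by apply: continuous_mulT => //; exact: continuous_cstT.
have ri := rho_integrable cp p01 rho0 rhoS.
have step1 : intRd (fun z => (phi z 1 * mH (t *: z + u) v ^+ N)%:E) =
    iint d (fun y => \int[rho N]_l (C ^+ N * \prod_(i < d) h i l (y i))%:E)%E.
  apply: eq_iint => y; set z := \row_(i < d) _.
  rewrite mHE exprMn.
  rewrite -(Rintegral_rho_exp cp p01 rho0 rhoS N (enorm (t *: z + u) ^+ 2 / (2 * v))).
  set q := enorm _ ^+ 2 / _.
  have ce : continuous (fun l : R => expR (- (q * `|l|))).
    by apply: continuous_expRT; apply: continuous_oppT; apply: continuous_mulT => //; exact: continuous_cstT.
  have -> : \int[rho N]_s expR (- (q * s)) = \int[rho N]_l expR (- (q * `|l|)).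
    apply: (eq_Rintegral_rho cp p01 rho0 rhoS) => //.
      apply/continuous_expRT/continuous_oppT/continuous_mulT.
        exact: continuous_cstT.
      by move=> x; exact: cvg_id.
    by move=> x /andP[x0 _]; rewrite ger0_norm.
  have fk : (\int[rho N]_l (expR (- (q * `|l|)))%:E)%E =
      (\int[rho N]_l expR (- (q * `|l|)))%:E.
    by rewrite /Rintegral fineK//; apply: integrable_fin_num => //; exact: ri.
  rewrite mulrA EFinM -fk -ge0_integralZl//; last 2 first.
  - exact: continuous_measurable_EFin.
  - by rewrite lee_fin mulr_ge0// phi_prod prodr_ge0// => i _; exact: gauss1_ge0.
  apply: eq_integral => l _; rewrite -EFinM; congr (_%:E).
  rewrite [phi _ _ * _]mulrC -mulrA; congr (_ * _).
  rewrite /h [RHS]big_split /= phi_prod; congr (_ * _).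
    by apply: eq_bigr => i _; rewrite mxE subr0.
  rewrite -expR_sum sumrN; congr (expR (- _)).
  rewrite /q enorm_sqr !mulr_suml; apply: eq_bigr => i _.
  by rewrite !mxE /W valKd; field.
have step2 : iint d (fun y => \int[rho N]_l (C ^+ N * \prod_(i < d) h i l (y i))%:E)%E =
    (\int[rho N]_l (C ^+ N * \prod_(i < d) H i l)%:E)%E.
  have D0 (l : R) : 0 < 1 + 1 * (`|l| / v) * t ^+ 2.
    by rewrite mul1r ltr_pwDl// mulr_ge0 ?sqr_ge0// divr_ge0// ltW.
  apply: (@iint_prod R _ T (rho N) h H d (fun=> C ^+ N)).
  - by [].
  - exact: measurable_cst.
  - by move=> i x y; rewrite mulr_ge0 ?gauss1_ge0 ?expR_ge0.
  - move=> i; apply: measurable_funM.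
      have mg := continuous_measurable_fun (@continuous_gauss1 R 1 0).
      exact: (measurableT_comp mg (@measurable_snd _ _ T R)).
    apply: measurableT_comp; first exact: measurable_expR.
    apply: measurable_funN; apply: measurable_funM; last exact: measurable_cst.
    apply: measurable_funM.
      have mN := continuous_measurable_fun cNv.
      exact: (measurableT_comp mN (@measurable_fst _ _ T R)).
    apply: measurable_funX; apply: measurable_funD; last exact: measurable_cst.
    by apply: measurable_funM; [exact: measurable_cst|exact: measurable_snd].
  - move=> i; apply: continuous_measurable_fun.
    have cD : continuous (fun l : R => 1 + 1 * (`|l| / v) * t ^+ 2).
      apply: continuous_addT; first exact: continuous_cstT.
      apply: continuous_mulT; last exact: continuous_cstT.
      by apply: continuous_mulT => //; exact: continuous_cstT.
    apply: continuous_mulT.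
      apply: continuous_invT => [|x]; last by rewrite gt_eqF ?sqrtr_gt0.
      by apply: continuousT_comp; [exact: cD|exact: sqrt_continuous].
    apply/continuous_expRT/continuous_oppT/continuous_mulT.
      by apply: continuous_mulT => //; exact: continuous_cstT.
    apply: continuous_invT => [|x]; last by rewrite gt_eqF ?mulr_gt0.
    by apply: continuous_mulT => //; exact: continuous_cstT.
  - by move=> i x; rewrite integral_gauss1_expR// divr_ge0// ltW.
rewrite /EZ step1 step2.
have ck : continuous (kernel_weight a tau (enorm u ^+ 2 / (2 * v))) by exact: continuous_kwt.
rewrite -RintegralZl//; last exact: ri.
congr fine; apply: eq_integral => l _; congr (_%:E); congr (_ * _).
have D0 := kernel_den_gt0 tau0 l.
rewrite /H big_split /= prodr_const card_ord mulrC.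
have -> : 1 + 1 * (`|l| / v) * t ^+ 2 = kernel_den tau l by rewrite /kernel_den /tau; ring.
congr (_ * _); last first.
  rewrite exprVn -powR12_sqrt ?(ltW D0)// -powR_mulrn ?powR_ge0// -powRrM powRN.
  by congr ((_ `^ _)^-1); rewrite /a; field.
rewrite -expR_sum sumrN; congr (expR (- _)).
rewrite /kernel_arg enorm_sqr !mulr_suml; apply: eq_bigr => i _.
rewrite /W valKd mulr0 add0r; field.
by rewrite vn0 gt_eqF.
Qed.

End gaussian_expectation.

(** * The sign of the Laplacian *)

Unset Implicit Arguments.

Theorem theorem4 (R : realType) (d : nat) (v c t : R) (nu : nat) :
  (3 <= d)%N -> 0 < v -> 0 < c < 1 -> (2 <= nu)%N ->
  0 <= t ->
  t <= Num.sqrt (((d%:R + 2) * (1 - c) * v) / (d%:R * nu%:R * (nu%:R - 1))) ->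
  let F := @Fpow R d nu t v c in
  (forall (i : 'I_d) (u : 'rV[R]_d), derivable F u (@ebasis R d i)) /\
  (forall (i : 'I_d) (u : 'rV[R]_d),
      derivable (fun x => derive F x (@ebasis R d i)) u (@ebasis R d i)) /\
  (forall u : 'rV[R]_d, laplacian F u <= 0).
Proof.
move=> d3 v0 /andP[c0 c1] nu2 t0 ht F.
(* Write [nu = n + 1], so that [n] counts the copies left after one is singled out; [n1] makes [n]
   positive. *)
case: nu nu2 ht @F => // n n1 ht F.
pose a : R := (d%:R - 2) / 2; pose b := a^-1.
have a0 : 0 < a by rewrite divr_gt0// subr_gt0 (ltr_nat R 2 d).
have b0 : 0 < b by rewrite invr_gt0.
pose p (x : R) : R := `|x| `^ b.
have cp : continuous p by exact: continuous_norm_powR.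
have p01 (x : R) : 0 <= x <= 1 -> 0 <= p x <= 1.
  move=> /andP[x0 x1]; rewrite powR_ge0/=.
  have <- : 1 `^ b = 1 :> R by rewrite powR1.
  by apply: ge0_ler_powR; rewrite ?nnegrE ?(ltW b0)// ger0_norm.
have [C C0 mHE] := mH_eq_scale_mixture d3 v0.
have [rho [rho0 rhoS]] := exists_uniform_convolution_powers cp.
pose tau := t ^+ 2 / v.
have tau0 : 0 <= tau by rewrite divr_ge0 ?sqr_ge0// ltW.
pose N := n.+1.
have N0 : 0 < N%:R :> R by rewrite ltr0n.
pose g0 (r : R) := \int[rho N]_l kernel_weight a tau r l.
pose g1 (r : R) := \int[rho N]_l (kernel_arg tau l * kernel_weight a tau r l).
pose g2 (r : R) := \int[rho N]_l (kernel_arg tau l * (kernel_arg tau l * kernel_weight a tau r l)).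
have dg0 (r : R) : is_derive r 1 g0 (- g1 r).
  have := is_derive_moment a tau0 N cp p01 rho0 rhoS r (@continuous_cstT R 1).
  have E (s : R) l : 1 * kernel_weight a tau s l = kernel_weight a tau s l by rewrite mul1r.
  under eq_fun => s do under eq_Rintegral => l _ do rewrite E.
  by under eq_Rintegral => l _ do rewrite E.
have dg1 (r : R) : is_derive r 1 g1 (- g2 r).
  exact: (is_derive_moment a tau0 N cp p01 rho0 rhoS r (continuous_kap tau0)).
have g00 r : 0 < g0 r by exact: (moment_gt0 a tau0 N cp p01 rho0 rhoS r).
pose e := c / N%:R.
pose k : R := (2 * v)^-1.
pose f (q : R) : R := (C ^+ N * g0 (k * q)) `^ e.
pose f1 (q : R) : R := (- (e * C ^+ N * k)) * ((C ^+ N * g0 (k * q)) `^ (e - 1) * g1 (k * q)).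
pose f2 (q : R) : R := (- (e * C ^+ N * k)) *
  ((e - 1) * (C ^+ N * g0 (k * q)) `^ (e - 1 - 1) * (C ^+ N * (- g1 (k * q) * k)) * g1 (k * q) +
   (C ^+ N * g0 (k * q)) `^ (e - 1) * (- g2 (k * q) * k)).
have CN0 : 0 < C ^+ N by rewrite exprn_gt0.
have y0 q : 0 < C ^+ N * g0 (k * q) by rewrite mulr_gt0.
have dk (q : R) : is_derive q 1 (fun q : R => k * q) k.
  have d0 : is_derive q 1 (fun x : R => x) 1 by exact: is_derive_id.
  by apply: (is_derive_eq (is_derive_scaleR k d0)); rewrite mulr1.
have dgk0 (q : R) : is_derive q 1 (fun q => g0 (k * q)) (- g1 (k * q) * k).
  exact: (@is_derive_compR R g0 (fun q => k * q) q _ _ (dg0 _) (dk q)).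
have dgk1 (q : R) : is_derive q 1 (fun q => g1 (k * q)) (- g2 (k * q) * k).
  exact: (@is_derive_compR R g1 (fun q => k * q) q _ _ (dg1 _) (dk q)).
have dCg (q : R) := is_derive_scaleR (C ^+ N) (dgk0 q).
have df (q : R) : is_derive q 1 f (f1 q).
  apply: (is_derive_eq (is_derive_powRR e (dCg q) (y0 q))).
  by rewrite /f1; ring.
have df1 (q : R) : is_derive q 1 f1 (f2 q).
  exact: (is_derive_scaleR _ (is_derive_mulR (is_derive_powRR (e - 1) (dCg q) (y0 q)) (dgk1 q))).
have FE : F = fun u => f (\sum_(j < d) u ord0 j ^+ 2).
  apply/funext => u; rewrite /F /Fpow /f (EZ_mH_pow _ _ d3 v0 C0 p01 mHE rho0 rhoS).
  by rewrite enorm_sqr [_ / (2 * v)]mulrC.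
rewrite FE; split; first by move=> i u; have [] := is_derive_radial df u i.
split; first by move=> i u; have [] := is_derive2_radial df df1 u i.
move=> u; rewrite (laplacian_radial df df1).
set q := \sum_(j < d) _.
have q0 : 0 <= q by rewrite sumr_ge0// => i _; rewrite sqr_ge0.
have k0 : 0 < k by rewrite invr_gt0 mulr_gt0.
pose r := k * q.
have r0 : 0 <= r by rewrite mulr_ge0// ltW.
have d0 : 0 < d%:R :> R by rewrite ltr0n (ltn_trans _ d3).
have nn0 : 0 < n%:R :> R by rewrite ltr0n.
(* The square of the bound on [t], rewritten with [a + 1 = d/2] and [a + 2 = (d + 2)/2]. *)
have htau : tau * (n.+1%:R * n%:R * (a + 1)) <= (a + 2) * (1 - c).
  have E1 : N%:R - 1 = n%:R :> R by rewrite /N -natr1 addrK.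
  have H : t ^+ 2 <= ((d%:R + 2) * (1 - c) * v) / (d%:R * N%:R * (N%:R - 1)).
    have X0 : 0 <= ((d%:R + 2) * (1 - c) * v) / (d%:R * N%:R * (N%:R - 1)).
      rewrite E1; apply: divr_ge0; last by rewrite !mulr_ge0.
      by rewrite mulr_ge0 ?(ltW v0)// mulr_ge0 ?subr_ge0 ?(ltW c1)// addr_ge0.
    by rewrite -(sqr_sqrtr X0) lerXn2r// nnegrE.
  rewrite E1 ler_pdivlMr ?mulr_gt0// in H.
  rewrite /tau mulrAC ler_pdivrMr//.
  have -> : t ^+ 2 * (n.+1%:R * n%:R * (a + 1)) = (t ^+ 2 * (d%:R * N%:R * n%:R)) / 2.
    by rewrite /a /N; field.
  have -> : (a + 2) * (1 - c) * v = ((d%:R + 2) * (1 - c) * v) / 2.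
    by rewrite /a; field.
  by rewrite ler_pM2r// invr_gt0.
have c01 : 0 <= c < 1 by rewrite ltW.
have MI := moment_inequality a0 tau0 r0 rho0 rhoS c01 htau.
rewrite -/(g0 r) -/(g1 r) -/(g2 r) in MI.
pose X := (C ^+ N * g0 r) `^ (e - 1 - 1).
have XE : (C ^+ N * g0 r) `^ (e - 1) = X * (C ^+ N * g0 r).
  rewrite /X [in RHS]powRB ?(gt_eqF (y0 _)) ?implybT// powRr1 ?(ltW (y0 _))//.
  by rewrite divfK// gt_eqF// y0.
have X0 : 0 <= X by exact: powR_ge0.
have e0 : 0 <= e by rewrite divr_ge0// ltW.
have qE : q = r / k by rewrite /r mulrC mulKf// gt_eqF.
(* With the lowest power [X] factored out, the Laplacian is a nonpositive multiple of the slack in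
   the moment inequality; the term in [a + 1] comes from [2 d = 4 (a + 1)]. *)
have -> : 2 * d%:R * f1 q + 4 * q * f2 q =
  - (4 * (e * (C ^+ N) ^+ 2 * k * X) *
     ((a + 1) * g0 r * g1 r + (1 - e) * g1 r * (r * g1 r) - g0 r * (r * g2 r))).
  rewrite /f1 /f2 -/r XE -/X {1}qE /a; field.
  by rewrite gt_eqF.
rewrite oppr_le0; apply: mulr_ge0; last by rewrite subr_ge0.
apply: mulr_ge0 => //; apply: mulr_ge0 => //; apply: mulr_ge0; last exact: ltW.
by rewrite mulr_ge0// sqr_ge0.
Qed.
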